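(* Let $p$ be an odd prime, let $\rho: SL_2(\mathbb{F}_p)\to GL(\mathcal{H})$ be the Weil representation on $\mathcal{H}=\mathbb{C}(\mathbb{F}_p)$, and let $T\subset SL_2(\mathbb{F}_p)$ be a maximal torus. For a character $\chi: T\to\mathbb{C}^\times$ put $\mathcal{H}_\chi=\{\phi\in\mathcal{H} : \rho(g)\phi=\chi(g)\phi \text{ for all } g\in T\}$, and let $\sigma_T$ be the unique character of $T$ of order $2$. If $T$ is a split torus, then for every character $\chi$ of $T$, $\dim\mathcal{H}_\chi=1$ if $\chi\neq\sigma_T$ and $\dim\mathcal{H}_\chi=2$ if $\chi=\sigma_T$. If $T$ is a non-split torus, then for every character $\chi$ of $T$, $\dim\mathcal{H}_\chi=1$ if $\chi\neq\sigma_T$ and $\dim\mathcal{H}_\chi=0$ if $\chi=\sigma_T$.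
   Context: Setting. $p$ is an odd prime, $\psi(z)=e^{2\pi i z/p}$ for $z\in\mathbb{F}_p$. $V=\mathbb{F}_p\times\mathbb{F}_p$ (column vectors $(t,w)$) carries the symplectic form $\omega((t,w),(t',w'))=tw'-wt'$. The Heisenberg group is $H=V\times\mathbb{F}_p$ with $(v,z)(v',z')=(v+v',z+z'+\tfrac12\omega(v,v'))$; $SL_2(\mathbb{F}_p)$ acts on $H$ by $g(v,z)=(gv,z)$. $\mathcal{H}=\mathbb{C}(\mathbb{F}_p)$ is the Hilbert space of complex functions on $\mathbb{F}_p$ with the standard Hermitian product. The Heisenberg representation $\pi$ of $H$ on $\mathcal{H}$ is determined by $\pi((t,0),0)[f](x)=f(x+t)$, $\pi((0,w),0)[f](x)=\psi(wx)f(x)$, $\pi(0,z)[f]=\psi(z)f$. Weil representation. $\rho:SL_2(\mathbb{F}_p)\to GL(\mathcal{H})$ is the linear representation satisfying $\rho(g)\pi(h)\rho(g)^{-1}=\pi(g(h))$ for all $g\in SL_2(\mathbb{F}_p)$, $h\in H$. It exists, and it is unique if $p\neq3$; for $p=3$ it denotes the canonical choice, namely the one with $\mathrm{Tr}\,\rho(g)=\sigma(-\det(\kappa(g)+I))$ whenever $g-I$ is invertible, where $\kappa(g)=(g+I)(g-I)^{-1}$ and $\sigma$ is the quadratic (Legendre) character of $\mathbb{F}_p^\times$. Tori. A maximal torus in $SL_2(\mathbb{F}_p)$ means the group of $\mathbb{F}_p$-points of a maximal algebraic torus of $SL_2$ defined over $\mathbb{F}_p$. It is split if it is conjugate in $SL_2(\mathbb{F}_p)$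 to $A=\{\mathrm{diag}(a,a^{-1}):a\in\mathbb{F}_p^\times\}$, and non-split otherwise; the non-split ones are exactly the images of the norm-one group $\{x\in\mathbb{F}_{p^2}^\times: N_{\mathbb{F}_{p^2}/\mathbb{F}_p}(x)=1\}$ under $\mathbb{F}_p$-algebra embeddings $\mathbb{F}_{p^2}\to M_2(\mathbb{F}_p)$. Maximal tori are cyclic of even order ($p-1$ if split, $p+1$ if non-split). *)

(* Defs.v *)
From HB Require Import structures.
From mathcomp Require Import all_boot all_order all_algebra all_fingroup.
From mathcomp Require Import ring closed_field complex mpoly.
From mathcomp Require Import reals trigo.

Set Implicit Arguments.
Unset Strict Implicit.
Unset Printing Implicit Defensive.

Import Order.TTheory GRing.Theory Num.Theory.
Local Open Scope ring_scope.
Local Open Scope complex_scope.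

Definition symp (F : fieldType) (v v' : 'cV[F]_2) : F :=
  v 0 0 * v' 1 0 - v 1 0 * v' 0 0.

Definition heis (p : nat) : Type := ('cV['F_p]_2 * 'F_p)%type.

HB.instance Definition _ p := Finite.on (heis p).

Section HeisenbergGroup.
Variable p : nat.
Implicit Types h : heis p.

Definition heis_mul h h' : heis p :=
  (h.1 + h'.1, h.2 + h'.2 + 2%:R^-1 * symp h.1 h'.1).
Definition heis_one : heis p := (0, 0).
Definition heis_inv h : heis p := (- h.1, - h.2).

Lemma heis_mulA : associative heis_mul.
Proof.
move=> [v a] [w b] [u c]; rewrite /heis_mul /symp /=; congr (_, _).
  by rewrite addrA.
rewrite !mxE; ring.
Qed.

Lemma heis_mul1 : left_id heis_one heis_mul.
Proof.
move=> [v a]; rewrite /heis_mul /symp /=; congr (_, _); first by rewrite add0r.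
by rewrite !mxE; ring.
Qed.

Lemma heis_mulV : left_inverse heis_one heis_inv heis_mul.
Proof.
move=> [v a]; rewrite /heis_mul /symp /=; congr (_, _); first by rewrite addNr.
by rewrite !mxE; ring.
Qed.

End HeisenbergGroup.

HB.instance Definition _ p := Finite_isGroup.Build (heis p)
  (@heis_mulA p) (@heis_mul1 p) (@heis_mulV p).


Definition SL2 (p : nat) : {set {'GL_2(p)}} := [set g | \det (GLval g) == 1].

Lemma SL2_group_set p : group_set (SL2 p).
Proof.
apply/group_setP; split=> [|g h]; first by rewrite inE GL_1E det1.
by rewrite !inE GL_MxE det_mulmx => /eqP -> /eqP ->; rewrite mulr1.
Qed.
Canonical SL2_group p := Group (SL2_group_set p).

Definition heis_act (p : nat) (g : {'GL_2(p)}) (h : heis p) : heis p :=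
  (GLval g *m h.1, h.2).

Lemma heis_actM p (g : {'GL_2(p)}) : g \in SL2 p ->
  {morph heis_act g : h h' / (h * h')%g}.
Proof.
rewrite inE => /eqP; rewrite (expand_det_row _ 0) !big_ord_recl big_ord0.
rewrite /cofactor !det_mx11 !mxE /= => detg [v a] [w b].
have j1 : lift ord0 ord0 = 1 :> 'I_2 by apply/val_inj.
have j0 : lift 1 0 = 0 :> 'I_2 by apply/val_inj.
move: detg; rewrite !j1 j0 => detg.
congr (_, _); rewrite /= ?mulmxDr // /symp !mxE !big_ord_recl !big_ord0 /= !j1.
congr (_ + _ * _); rewrite -[LHS]mul1r -[X in X * _]detg.
by rewrite !expr0 ?expr1 ?addr0; ring.
Qed.

Definition vec2 (F : nzRingType) (t w : F) : 'cV[F]_2 :=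
  \col_(i < 2) (if i == 0 then t else w).

Section HeisenbergRep.
Variables (R : realType) (p : nat).

Definition psi (z : 'F_p) : R[i] :=
  cos (2 * pi * (z : nat)%:R / p%:R) +i* sin (2 * pi * (z : nat)%:R / p%:R).

(* The scalars are written R[i]^o so that the vectType R[i] structure on
   finite functions is inferred. *)
Definition Hilb : vectType R[i] := {ffun 'F_p -> R[i]^o}.

(* ((t,w),z) = ((t,0),0) ((0,w),0) (0, z - tw/2) in the Heisenberg group. *)
Definition heis_fun (h : heis p) (f : Hilb) : Hilb :=
  let t := h.1 0 0 in let w := h.1 1 0 in
  [ffun x => psi (h.2 + 2%:R^-1 * (t * w) + w * x) * f (x + t)].

Lemma heis_fun_linear h : linear (heis_fun h).
Proof.
move=> a f g; apply/ffunP => x; rewrite !ffunE /= mulrDr /GRing.scale /=.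
by rewrite !mulrA (mulrC a).
Qed.
HB.instance Definition _ h :=
  GRing.isLinear.Build R[i] Hilb Hilb _ (heis_fun h) (heis_fun_linear h).

Definition heis_rep (h : heis p) : 'End(Hilb) := linfun (heis_fun h).

Lemma psi0 : psi 0 = 1.
Proof. by rewrite /psi /= mulr0 mul0r cos0 sin0. Qed.

Hypothesis p_pr : prime p.

Lemma psiD : {morph psi : x y / x + y >-> x * y}.
Proof.
move=> x y; rewrite /psi.
have p0 : p%:R != 0 :> R by rewrite pnatr_eq0 -lt0n prime_gt0.
have e : 2 * pi * (x : nat)%:R / p%:R + 2 * pi * (y : nat)%:R / p%:R
  = 2 * pi * (nat_of_ord (x + y))%:R / p%:R + (pi *+ 2) *+ ((x + y) %/ p)%N :> R.
  have -> : nat_of_ord (x + y) = ((x + y) %% p)%N :> nat.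
    by congr (_ %% _)%N; rewrite Fp_cast.
  have h : ((x : nat)%:R + (y : nat)%:R : R) =
      ((x + y) %/ p)%N%:R * p%:R + ((x + y) %% p)%N%:R.
    by rewrite -natrD {1}(divn_eq (x + y) p) natrD natrM.
  rewrite -[(pi *+ 2) *+ _]mulr_natr -[pi *+ 2]mulr_natl -!mulrDl -mulrDr h.
  by field.
have pc := periodicn (@cosD2pi R); have ps := periodicn (@sinD2pi R).
rewrite -(pc ((x + y) %/ p)%N) -(ps ((x + y) %/ p)%N) -e cosD sinD.
by apply/eqP; rewrite eq_complex /= addrC [X in _ && (_ == X)]addrC !eqxx ?andbT /=.
Qed.

Lemma heis_rep_transl t (f : Hilb) x :
  heis_rep (vec2 t 0, 0) f x = f (x + t).
Proof.
by rewrite lfunE /= ffunE !mxE /= mulr0 mul0r mulr0 !addr0 psi0 mul1r.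
Qed.

Lemma heis_rep_mod w (f : Hilb) x :
  heis_rep (vec2 0 w, 0) f x = psi (w * x) * f x.
Proof. by rewrite lfunE /= ffunE !mxE /= mul0r mulr0 !addr0 add0r. Qed.

Lemma heis_rep_center z (f : Hilb) : heis_rep (0, z) f = psi z *: f.
Proof.
by apply/ffunP=> x; rewrite lfunE /= !ffunE !mxE /= !mul0r mulr0 !addr0.
Qed.

Hypothesis p_odd : odd p.

Lemma heis_repM h h' : heis_rep (h * h')%g = (heis_rep h \o heis_rep h')%VF.
Proof.
have two : 2%:R != 0 :> 'F_p.
  rewrite -(dvdn_pcharf (pchar_Fp p_pr)) dvdn_prime2 //.
  by apply/eqP => p2; move: (p_odd); rewrite p2.
apply/lfunP => f; apply/ffunP => x; rewrite comp_lfunE !lfunE /= !ffunE.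
rewrite mulrA -psiD !mxE /symp; congr (psi _ * _); last first.
  by rewrite addrA.
have -> : (h * h')%g.2 = h.2 + h'.2 +
  2%:R^-1 * (h.1 0 0 * h'.1 1 0 - h.1 1 0 * h'.1 0 0) by [].
by field.
Qed.

Lemma heis_rep_unique (pi' : heis p -> 'End(Hilb)) :
  (forall h h', pi' (h * h')%g = (pi' h \o pi' h')%VF) ->
  (forall t (f : Hilb) x, pi' (vec2 t 0, 0) f x = f (x + t)) ->
  (forall w (f : Hilb) x, pi' (vec2 0 w, 0) f x = psi (w * x) * f x) ->
  (forall z (f : Hilb), pi' (0, z) f = psi z *: f) ->
  pi' =1 heis_rep.
Proof.
move=> pM pT pW pZ [v z].
have -> : (v, z) = (((vec2 (v 0%R 0%R) 0%R, 0%R) : heis p) *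
    (((vec2 0 (v 1 0))%R, 0%R) : heis p) *
    ((0%R, (z - 2%:R^-1 * (v 0 0 * v 1 0))%R) : heis p))%g :> heis p.
  rewrite /mulg /= /heis_mul /symp /= !mxE /=; congr (_, _); last by ring.
  apply/colP => i; rewrite !mxE addr0.
  by case: i => [] [|[|//]] lti; rewrite /= ?addr0 ?add0r; congr (v _ _); apply/val_inj.
rewrite !pM !heis_repM; apply/lfunP=> f; apply/ffunP => x.
by rewrite !comp_lfunE /= pT heis_rep_transl pW heis_rep_mod pZ heis_rep_center.
Qed.

End HeisenbergRep.

Definition legendre (R : realType) (p : nat) (a : 'F_p) : R[i] :=
  if a == 0 then 0 else if [exists b : 'F_p, b ^+ 2 == a] then 1 else -1.

Definition trace_ffun (R : realType) (p : nat) (u : 'End(Hilb R p)) : R[i] :=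
  \sum_(x : 'F_p) u [ffun y => (y == x)%:R] x.

Definition kappa (p : nat) (g : {'GL_2(p)}) : 'M['F_p]_2 :=
  (GLval g + 1%:M) *m invmx (GLval g - 1%:M).

(* Only the values of rho on SL2 p matter.  For invertible u, (u^-1)%VF is the
   inverse of u; invertibility of rho g follows from weil1 and weilM.  For p = 3
   the first three conditions determine rho only up to a character of SL2 3. *)
Record is_weil_rep (R : realType) (p : nat)
    (rho : {'GL_2(p)} -> 'End(Hilb R p)) : Prop := IsWeilRep {
  weil1 : rho 1%g = \1%VF;
  weilM : {in SL2 p &, forall g g', rho (g * g')%g = (rho g \o rho g')%VF};
  weil_egorov : {in SL2 p, forall g (h : heis p),
    (rho g \o heis_rep R h \o (rho g)^-1)%VF = heis_rep R (heis_act g h)};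
  weil_trace3 : p = 3%N ->
    {in SL2 p, forall g, GLval g - 1%:M \in unitmx ->
      trace_ffun (rho g) = legendre R (- \det (kappa g + 1%:M))}
}.

Definition Fbar (p : nat) : countClosedFieldType :=
  tag (countable_algebraic_closure 'F_p).

Definition toFbar (p : nat) : {rmorphism 'F_p -> Fbar p} :=
  sval (tagged (countable_algebraic_closure 'F_p)).

Lemma toFbar_integral p : integralRange (toFbar p).
Proof. exact: svalP (tagged (countable_algebraic_closure 'F_p)). Qed.

Section AlgebraicTori.
Variable p : nat.
Local Notation K := (Fbar p).
Implicit Types D : 'M[K]_2 -> Prop.

Definition entries_eval (P : {mpoly K[2 * 2]}) (x : 'M[K]_2) : K :=
  P.@[fun k => mxvec x 0 k].

Definition vanishes_on D (P : {mpoly K[2 * 2]}) : Prop :=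
  forall x, D x -> entries_eval P x = 0.

Definition zariski_closed D : Prop :=
  forall x, (forall P, vanishes_on D P -> entries_eval P x = 0) -> D x.

(* The vanishing ideal of D is the K-span of its elements with coefficients in
   F_p (and not merely: D is the zero set of these). *)
Definition defined_over_Fp D : Prop :=
  forall P, vanishes_on D P ->
  exists s : seq (K * {mpoly 'F_p[2 * 2]}),
    (forall c, c \in s -> vanishes_on D (map_mpoly (toFbar p) c.2)) /\
    P = \sum_(c <- s) c.1 *: map_mpoly (toFbar p) c.2.

Definition Gm (n : nat) (t : 'rV[K]_n) : Prop := forall i, t 0 i != 0.

(* f is a closed immersion of algebraic groups G_m^n -> SL_2 with image D:
   its entries are Laurent polynomials in t (polynomials P in t and 1/t) and its
   inverse is the restriction to D of polynomials Q in the matrix entries. *)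
Definition is_alg_torus D : Prop :=
  zariski_closed D /\ (forall x, D x -> \det x = 1) /\
  exists (n : nat) (f : 'rV[K]_n -> 'M[K]_2)
      (P : 'I_2 -> 'I_2 -> {mpoly K[n + n]}) (Q : 'I_n -> {mpoly K[2 * 2]}),
    [/\ forall t, Gm t -> forall i j,
          f t i j = (P i j).@[fun k => row_mx t (map_mx GRing.inv t) 0 k],
        forall t u, Gm t -> Gm u -> f (map2_mx *%R t u) = f t *m f u,
        forall t, Gm t -> forall k, entries_eval (Q k) (f t) = t 0 k
      & forall x, D x <-> exists2 t, Gm t & x = f t].

Definition is_max_alg_torus D : Prop :=
  is_alg_torus D /\
  forall D', is_alg_torus D' -> (forall x, D x -> D' x) ->
  forall x, D' x -> D x.

End AlgebraicTori.

Definition is_max_torus (p : nat) (T : {group {'GL_2(p)}}) : Prop :=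
  exists D : 'M[Fbar p]_2 -> Prop,
    [/\ is_max_alg_torus D, defined_over_Fp D
      & forall g : {'GL_2(p)},
          (g \in T) <-> (g \in SL2 p /\ D (map_mx (toFbar p) (GLval g)))].

Definition diag_torus (p : nat) : {set {'GL_2(p)}} :=
  [set g : {'GL_2(p)} | [exists a : 'F_p, (a != 0) &&
     (GLval g == diag_mx (\row_(i < 2) if i == 0 then a else a^-1))]].

Definition is_split_torus (p : nat) (T : {group {'GL_2(p)}}) : Prop :=
  exists2 x, x \in SL2 p & T :=: (diag_torus p :^ x)%g.

Section Characters.
Variables (R : realType) (p : nat) (T : {group {'GL_2(p)}}).
Implicit Types chi : {'GL_2(p)} -> R[i].

(* Values of chi outside T are irrelevant; chi g != 0 on T follows. *)
Definition is_char chi : Prop :=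
  chi 1%g = 1 /\ {in T &, forall g h, chi (g * h)%g = chi g * chi h}.

Definition is_char_order2 chi : Prop :=
  [/\ is_char chi, exists2 g, g \in T & chi g != 1
    & {in T, forall g, chi g ^+ 2 = 1}].

Definition isotypic (rho : {'GL_2(p)} -> 'End(Hilb R p)) chi :
    {vspace Hilb R p} :=
  (\bigcap_(g in T) passmx.leigenspace (rho g) (chi g))%VS.

Lemma isotypicP (rho : {'GL_2(p)} -> 'End(Hilb R p)) chi (phi : Hilb R p) :
  reflect (forall g, g \in T -> rho g phi = chi g *: phi)
          (phi \in isotypic rho chi).
Proof.
apply: (iffP idP) => [|h].
  rewrite memvE => /subv_bigcapP h g gT; move: (h g gT).
  rewrite -memvE memv_ker add_lfunE opp_lfunE scale_lfunE id_lfunE subr_eq0.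
  by move/eqP.
rewrite memvE; apply/subv_bigcapP => g gT; rewrite -memvE memv_ker.
by rewrite add_lfunE opp_lfunE scale_lfunE id_lfunE h // subrr.
Qed.

End Characters.

(* Main.v *)
(** Over the algebraic closure a maximal torus is the centralizer in SL_2 of an
    involution y of trace 0. If it is defined over F_p, Frobenius maps y to a
    multiple of itself, so some multiple Y of y has entries in F_p and T is the
    centralizer of Y in SL_2(F_p): cyclic of order n = p - 1 or p + 1, with
    g - 1 invertible for every g <> 1 in T.

    For such g, averaging rho(g) over conjugation by the Heisenberg operators
    gives tr rho(g) tr rho(g^-1) = 1. Hence the multiplicities m_chi satisfy
    sum (m_chi - 1)^2 = 1, while sum (m_chi - 1) = p - n: a single m_chi differs
    from 1, and it equals 1 + p - n. Since SL_2(F_p) is generated by elements of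
    order p and n is prime to p, det rho is trivial on T; comparing with the
    product of all characters of T, which is the quadratic one, shows that the
    exceptional chi is the quadratic character. *)

Require Import Defs.
From HB Require Import structures.
From mathcomp Require Import all_boot all_order all_algebra all_fingroup.
From mathcomp Require Import cyclic finfield separable cyclotomic.
From mathcomp Require Import ring zify closed_field mpoly.
From mathcomp Require Import complex reals trigo.
Import Order.TTheory GRing.Theory Num.Theory.
Local Open Scope ring_scope.
Local Open Scope complex_scope.

Set Implicit Arguments.
Unset Strict Implicit.
Unset Printing Implicit Defensive.

(** * Two-by-two matrices *)

Lemma mx2P (R : nzRingType) (A B : 'M[R]_2) :
  A 0 0 = B 0 0 -> A 0 1 = B 0 1 -> A 1 0 = B 1 0 -> A 1 1 = B 1 1 -> A = B.
Proof.
move=> h00 h01 h10 h11.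
have ord2 (k : 'I_2) : (k = 0) \/ (k = 1).
  by case: k => [[|[|//]] lt]; [left|right]; apply/val_inj.
by apply/matrixP => i j; case: (ord2 i) => ->; case: (ord2 j) => ->.
Qed.

Lemma ord2S : lift ord0 ord0 = 1 :> 'I_2. Proof. exact/val_inj. Qed.

Lemma mulmx2E (R : nzRingType) (A B : 'M[R]_2) i j :
  (A *m B) i j = A i 0 * B 0 j + A i 1 * B 1 j.
Proof. by rewrite mxE !big_ord_recl big_ord0 addr0 ord2S. Qed.

Lemma trmx2E (R : nzRingType) (A : 'M[R]_2) : \tr A = A 0 0 + A 1 1.
Proof. by rewrite /mxtrace !big_ord_recl big_ord0 addr0 ord2S. Qed.

Lemma detmx2E (R : comNzRingType) (A : 'M[R]_2) :
  \det A = A 0 0 * A 1 1 - A 0 1 * A 1 0.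
Proof.
rewrite (expand_det_row _ 0) !big_ord_recl big_ord0 /cofactor !det_mx11 !mxE /=.
have l0 : lift 0 0 = 1 :> 'I_2 by exact/val_inj.
have l1 : lift (lift ord0 ord0) 0 = 0 :> 'I_2 by exact/val_inj.
by rewrite l1 !l0 /=; ring.
Qed.

Definition mx2E := (mulmx2E, trmx2E, detmx2E).

(** Cayley-Hamilton with vanishing trace. *)
Lemma traceless_sqr (R : comNzRingType) (Y : 'M[R]_2) :
  \tr Y = 0 -> Y *m Y = (- \det Y)%:M.
Proof.
rewrite trmx2E => /eqP; rewrite addr_eq0 => /eqP h.
by apply: mx2P; rewrite !mx2E !mxE /= h; ring.
Qed.

(** Up to sign, and a factor 2 off the diagonal, the entries of YZ - ZY are the minors of the
    coordinate vectors (a, b, c) and (a', b', c'). When they vanish, dividing by a nonzero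
    coordinate of [Y] gives the ratio. *)
Lemma traceless_comm (F : fieldType) (Y Z : 'M[F]_2) : 2%:R != 0 :> F ->
  \tr Y = 0 -> \tr Z = 0 -> Y != 0 -> Y *m Z = Z *m Y -> exists c, Z = c *: Y.
Proof.
move=> two; rewrite !trmx2E => /eqP; rewrite addrC addr_eq0 => /eqP hY.
move=> /eqP; rewrite addrC addr_eq0 => /eqP hZ Y0 YZ.
have e i j := congr1 (fun M : 'M[F]_2 => M i j) YZ.
have e00 := e 0 0; have e01 := e 0 1; have e10 := e 1 0.
move: e00 e01 e10; rewrite !mulmx2E hY hZ.
set a := Y 0 0; set b := Y 0 1; set c := Y 1 0.
set a' := Z 0 0; set b' := Z 0 1; set c' := Z 1 0 => e00 e01 e10.
have bc : b * c' = c * b'.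
  by apply/eqP; rewrite -subr_eq0; apply/eqP; rewrite -[RHS](subrr (a * a' + b * c')) {2}e00; ring.
have ab : a * b' = b * a'.
  apply/(mulfI two)/eqP; rewrite -subr_eq0; apply/eqP.
  transitivity ((a * b' + b * - a') - (a' * b + b' * - a)); first by ring.
  by rewrite e01 subrr.
have ac : a * c' = c * a'.
  apply/(mulfI two)/eqP; rewrite -subr_eq0; apply/eqP.
  transitivity ((c' * a + - a' * c) - (c * a' + - a * c')); first by ring.
  by rewrite e10 subrr.
have [az|an] := eqVneq a 0; last first.
  exists (a' / a); apply: mx2P; rewrite !mxE ?hY ?hZ -/a -/b -/c -/a' -/b' -/c'.
  - by field.
  - by apply: (mulfI an); rewrite ab; field.
  - by apply: (mulfI an); rewrite ac; field.
  - by field.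
have [bz|bn] := eqVneq b 0; last first.
  exists (b' / b); apply: mx2P; rewrite !mxE ?hY ?hZ -/a -/b -/c -/a' -/b' -/c'.
  - by apply: (mulfI bn); rewrite -ab; field.
  - by field.
  - by apply: (mulfI bn); rewrite bc; field.
  - by apply: (mulfI bn); rewrite mulrN -ab; field.
have cn : c != 0.
  apply: contraNneq Y0 => cz; apply/eqP/mx2P; rewrite !mxE ?hY -/a //.
  by rewrite az oppr0.
exists (c' / c); apply: mx2P; rewrite !mxE ?hY ?hZ -/a -/b -/c -/a' -/b' -/c'.
- by apply: (mulfI cn); rewrite -ac; field.
- by apply: (mulfI cn); rewrite -bc; field.
- by field.
- by apply: (mulfI cn); rewrite mulrN -ac; field.
Qed.

Definition traceless (F : fieldType) (A : 'M[F]_2) := A - (\tr A / 2%:R)%:M.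

Lemma trace_traceless (F : fieldType) (A : 'M[F]_2) : 2%:R != 0 :> F ->
  \tr (traceless A) = 0.
Proof.
by move=> two; rewrite /traceless raddfB /= mxtrace_scalar -[_ *+ 2]mulr_natr divfK ?subrr.
Qed.

Lemma comm_traceless (F : fieldType) (A B : 'M[F]_2) :
  A *m B = B *m A -> A *m traceless B = traceless B *m A.
Proof.
by move=> AB; rewrite /traceless mulmxBr mulmxBl AB scalar_mxC.
Qed.

(** The traceless part of [A] also commutes with [Y], hence is a multiple of it; the centralizer is
    thus the plane spanned by 1 and [Y]. *)
Lemma centralizer_traceless (F : fieldType) (Y A : 'M[F]_2) :
  2%:R != 0 :> F -> \tr Y = 0 -> Y != 0 -> A *m Y = Y *m A ->
  exists b, A = (\tr A / 2%:R)%:M + b *: Y.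
Proof.
move=> two trY Y0 AY.
have [|b hb] := traceless_comm two trY (trace_traceless A two) Y0.
  by apply: comm_traceless.
by exists b; rewrite -hb addrC subrK.
Qed.

(** This is the norm form of the algebra spanned by 1 and [Y], in which Y^2 = - det Y. *)
Lemma det_centralizer (F : fieldType) (Y : 'M[F]_2) a b : \tr Y = 0 ->
  \det (a%:M + b *: Y) = a ^+ 2 + b ^+ 2 * \det Y.
Proof.
rewrite trmx2E => /eqP; rewrite addrC addr_eq0 => /eqP h.
by rewrite !mx2E !mxE /= h; ring.
Qed.

Lemma mul_centralizer (F : fieldType) (Y : 'M[F]_2) a b c d : \tr Y = 0 ->
  (a%:M + b *: Y) *m (c%:M + d *: Y) =
  (a * c - b * d * \det Y)%:M + (a * d + b * c) *: Y.
Proof.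
rewrite trmx2E => /eqP; rewrite addrC addr_eq0 => /eqP h.
by apply: mx2P; rewrite !mx2E !mxE /= h; ring.
Qed.

Lemma two_neq0_Fp (p : nat) : prime p -> odd p -> 2%:R != 0 :> 'F_p.
Proof.
move=> p_pr p_odd; rewrite -(dvdn_pcharf (pchar_Fp p_pr)) dvdn_prime2 //.
by apply/eqP => p2; move: p_odd; rewrite p2.
Qed.

(** * Maximal tori and Frobenius *)

Lemma closed_root (K : closedFieldType) n (t : K) : (0 < n)%N ->
  exists s, s ^+ n = t.
Proof.
case: n => // n _; have [x hx] := @solve_monicpoly K n.+1 (fun i => if i == 0%N then t else 0) isT.
exists x; rewrite hx big_ord_recl /= expr0 mulr1 big1 ?addr0 // => i _.
by rewrite mul0r.
Qed.

Section FrobeniusFixedPoints.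
Variables (p : nat) (p_pr : prime p).

Lemma pchar_Fbar : p \in [pchar Fbar p].
Proof. exact: rmorph_pchar (toFbar p) _ (pchar_Fp p_pr). Qed.

(** X^p - X is the product of all X - a with a in F_p, so it has no further roots in the closure. *)
Lemma FbarX_eq x : x ^+ p = x -> exists a, toFbar p a = x.
Proof.
move=> xp.
have := congr1 (map_poly (toFbar p)) (finField_genPoly 'F_p).
rewrite card_Fp // rmorphB rmorph_prod /= map_polyXn map_polyX => e.
have := congr1 (fun q => q.[x]) e; rewrite hornerD hornerN hornerXn hornerX xp subrr.
rewrite horner_prod => /esym/eqP/prodf_eq0 [a _].
rewrite rmorphB /= map_polyX map_polyC hornerXsubC subr_eq0 => /eqP ->.
by exists a.
Qed.

Lemma toFbarX a : (toFbar p a) ^+ p = toFbar p a.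
Proof. by rewrite -rmorphXn; have := expf_card a; rewrite card_Fp // => ->. Qed.

Definition Frob (M : 'M[Fbar p]_2) := map_mx (pFrobenius_aut pchar_Fbar) M.

Lemma Frob_fixed (M : 'M[Fbar p]_2) : Frob M = M -> exists N, M = map_mx (toFbar p) N.
Proof.
move=> FM.
have h i j : exists a, toFbar p a == M i j.
  have /FbarX_eq [a <-] : M i j ^+ p = M i j; last by exists a.
  by rewrite -[in RHS]FM mxE pFrobenius_autE.
exists (\matrix_(i, j) xchoose (h i j)); apply/matrixP => i j; rewrite !mxE.
by rewrite (eqP (xchooseP (h i j))).
Qed.

(** A polynomial P with coefficients in F_p satisfies P(Frob x) = P(x)^p, so it vanishes at [Frob x]
    as soon as it does at x. Such polynomials span the vanishing ideal of [D], and [D] is closed. *)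
Lemma defined_over_Fp_Frob (D : 'M[Fbar p]_2 -> Prop) :
  zariski_closed D -> defined_over_Fp D -> forall x, D x -> D (Frob x).
Proof.
move=> closedD defD x Dx; apply: closedD => P /defD [s [sD ->]].
rewrite /entries_eval raddf_sum big1_seq //= => c cs.
rewrite mevalZ; have /(_ x Dx) := sD c cs.
rewrite /entries_eval => e0; suff -> : (map_mpoly (toFbar p) c.2).@[fun k => mxvec (Frob x) 0 k]
  = pFrobenius_aut pchar_Fbar (map_mpoly (toFbar p) c.2).@[fun k => mxvec x 0 k].
  by rewrite e0 rmorph0 mulr0.
have E v : (map_mpoly (toFbar p) c.2).@[v] = \sum_(m : 'X_{1..(2 * 2) < mmeasure mdeg c.2})
    toFbar p c.2@_m * \prod_i v i ^+ m i.
  rewrite (map_mpolyE (toFbar p) (leqnn (mmeasure mdeg c.2))) (rmorph_sum (meval v)).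
  by apply: eq_bigr => m _; rewrite -mevalX -mevalZ.
rewrite !E rmorph_sum; apply: eq_bigr => m _.
rewrite rmorphM [X in _ = X * _]pFrobenius_autE toFbarX rmorph_prod; congr (_ * _).
apply: eq_bigr => i _; rewrite rmorphXn; congr (_ ^+ _).
by case/mxvec_indexP: i => i j; rewrite !mxvecE mxE.
Qed.
End FrobeniusFixedPoints.

(** * The centralizer of a trace-zero involution as an algebraic torus *)

Section CentralizerParam.
Variables (K : fieldType) (y : 'M[K]_2).
Hypotheses (two : 2%:R != 0 :> K) (tr0 : \tr y = 0) (yy : y *m y = 1%:M).

Definition centralizer_torus (x : 'M[K]_2) : Prop := \det x = 1 /\ x *m y = y *m x.

(** The matrix acting as t on the eigenspace of [y] for 1 and as t^-1 on the one for -1. *)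
Definition torus_param (t : K) : 'M[K]_2 :=
  ((t + t^-1) / 2%:R)%:M + ((t - t^-1) / 2%:R) *: y.

Lemma det_involution : \det y = -1.
Proof.
have := traceless_sqr tr0; rewrite yy => /(congr1 (fun M : 'M[K]_2 => M 0 0)).
by rewrite !mxE /= => e; rewrite -[LHS]opprK -[- \det y]mulr1n -e.
Qed.

Lemma involution_neq0 : y != 0.
Proof.
apply: contra_eq_neq det_involution => ->.
by rewrite det0 eq_sym oppr_eq0 oner_eq0.
Qed.

Lemma torus_paramM s t : s != 0 -> t != 0 ->
  torus_param (s * t) = torus_param s *m torus_param t.
Proof.
move=> s0 t0; rewrite /torus_param mulmxDl !mulmxDr -scalar_mxM -!scalemxAr -!scalemxAl yy.
rewrite mul_scalar_mx mul_mx_scalar !scalerA scalemx1.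
pose a (u : K) := (u + u^-1) / 2%:R; pose b (u : K) := (u - u^-1) / 2%:R.
rewrite -/(a s) -/(a t) -/(b s) -/(b t) -/(a (s * t)) -/(b (s * t)).
transitivity ((a s * a t + b t * b s)%:M + (b t * a s + b s * a t) *: y); last first.
  by rewrite raddfD scalerDl /= addrACA; congr (_ + _); rewrite addrC.
by rewrite /a /b; congr (_%:M + _ *: _); field; rewrite s0 t0 two.
Qed.

Lemma torus_param_centralizer t : t != 0 -> centralizer_torus (torus_param t).
Proof.
move=> t0; split.
  rewrite /torus_param det_centralizer // det_involution.
  by field; rewrite t0 two.
by rewrite /torus_param mulmxDl mulmxDr -scalemxAl -scalemxAr scalar_mxC.
Qed.

(** Writing x = a + b y, the determinant condition reads (a + b)(a - b) = 1, so t = a + b is a unit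
    with inverse a - b. *)
Lemma centralizer_param x : centralizer_torus x ->
  exists2 t, t != 0 & x = torus_param t.
Proof.
case=> dx xy; have [b xE] := centralizer_traceless two tr0 involution_neq0 xy.
move: dx; rewrite xE det_centralizer // det_involution.
set a := _ / _ => e.
have ab : (a + b) * (a - b) = 1 by rewrite -e; ring.
have u0 : a + b != 0 by apply: contra_eq_neq ab => ->; rewrite mul0r eq_sym oner_neq0.
have iv : (a + b)^-1 = a - b by apply: (mulfI u0); rewrite divff.
exists (a + b) => //; rewrite /torus_param iv.
by congr (_%:M + _ *: _); field.
Qed.

(** The two traces are t + t^-1 and t - t^-1. This recovers t polynomially from the matrix entries,
    as a closed immersion requires. *)
Lemma torus_param_coord t : t != 0 ->
  2%:R^-1 * (\tr (torus_param t) + \tr (torus_param t *m y)) = t.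
Proof.
move=> t0; rewrite /torus_param mulmxDl -scalemxAl yy mul_scalar_mx.
have trE (a : K) : \tr (a%:M : 'M_2) = a * 2%:R by rewrite mxtrace_scalar mulr_natr.
by rewrite !mxtraceD !mxtraceZ tr0 !trE; field; rewrite t0 two.
Qed.
End CentralizerParam.

Section CentralizerTorus.
Variables (p : nat) (y : 'M[Fbar p]_2).
Hypotheses (two : 2%:R != 0 :> Fbar p) (tr0 : \tr y = 0) (yy : y *m y = 1%:M).
Local Notation K := (Fbar p).

Let X i j : {mpoly K[2 * 2]} := 'X_(mxvec_index i j).

Lemma centralizer_torus_closed : zariski_closed (centralizer_torus y).
Proof.
move=> x hx.
have eX v i j : (X i j).@[fun k => mxvec v 0 k] = v i j by rewrite mevalXU mxvecE.
split.
  apply/eqP; rewrite -subr_eq0; apply/eqP.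
  have := hx (X 0 0 * X 1 1 - X 0 1 * X 1 0 - 1).
  rewrite /vanishes_on /entries_eval => h.
  rewrite detmx2E -[RHS]h => [|v [dv _]]; rewrite !(mevalB, mevalM, meval1) !eX //.
  by rewrite -detmx2E dv subrr.
apply/matrixP => i j; apply/eqP; rewrite -subr_eq0; apply/eqP.
have := hx (X i 0 * (y 0 j)%:MP + X i 1 * (y 1 j)%:MP -
            ((y i 0)%:MP * X 0 j + (y i 1)%:MP * X 1 j)).
rewrite /vanishes_on /entries_eval => h.
rewrite !mulmx2E -[RHS]h => [|v [_ vy]];
  rewrite !(mevalB, mevalD, mevalM, mevalC) !eX //.
by rewrite -!mulmx2E vy subrr.
Qed.

Lemma centralizer_torus_alg : is_alg_torus (centralizer_torus y).
Proof.
split; first exact: centralizer_torus_closed.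
split; first by move=> x [].
exists 1%N, (fun t : 'rV_1 => torus_param y (t 0 0)).
pose h : {mpoly K[1 + 1]} := (2%:R^-1)%:MP.
(* The left variable stands for t and the right one for 1/t. *)
exists (fun i j => ('X_(lshift 1 0) + 'X_(rshift 1 0)) * h * ((i == j)%:R)%:MP +
  ('X_(lshift 1 0) - 'X_(rshift 1 0)) * h * (y i j)%:MP).
pose h' : {mpoly K[2 * 2]} := (2%:R^-1)%:MP.
exists (fun _ => h' * (X 0 0 + X 1 1 + (X 0 0 * (y 0 0)%:MP + X 0 1 * (y 1 0)%:MP +
   (X 1 0 * (y 0 1)%:MP + X 1 1 * (y 1 1)%:MP)))).
split.
- move=> t _ i j; rewrite !(mevalB, mevalD, mevalM, mevalC, mevalXU).
  by rewrite row_mxEl row_mxEr !mxE mulr_natr.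
- by move=> t u /(_ 0) t0 /(_ 0) u0; rewrite mxE torus_paramM.
- move=> t /(_ 0) t0 k; rewrite (ord1 k) /entries_eval.
  rewrite !(mevalB, mevalD, mevalM, mevalC, mevalXU) !mxvecE.
  set x := torus_param y _.
  have -> : x 0 0 * y 0 0 + x 0 1 * y 1 0 + (x 1 0 * y 0 1 + x 1 1 * y 1 1) = \tr (x *m y).
    by rewrite trmx2E !mulmx2E.
  by rewrite -trmx2E torus_param_coord.
- move=> x; split=> [/(centralizer_param two tr0 yy) [t t0 ->]|[t /(_ 0) t0 ->]].
    by exists (\row_ _ t) => [i|]; rewrite mxE.
  exact: torus_param_centralizer.
Qed.
End CentralizerTorus.

Section MaximalTori.
Variables (p : nat) (p_pr : prime p) (p_odd : odd p).
Local Notation K := (Fbar p).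

Lemma two_neq0_Fbar : 2%:R != 0 :> K.
Proof. by rewrite -(rmorph_nat (toFbar p)) fmorph_eq0 two_neq0_Fp. Qed.

Let two := two_neq0_Fbar.

Lemma alg_torus_comm (D : 'M[K]_2 -> Prop) : is_alg_torus D ->
  forall x x', D x -> D x' -> x *m x' = x' *m x.
Proof.
case=> _ [_ [n [f [P [Q [_ fM _ Df]]]]]] x x' /Df[t Gt ->] /Df[u Gu ->].
rewrite -!fM //; congr f; apply/rowP => i; rewrite !mxE mulrC //.
Qed.

(** The coordinates of a parameter have p-th roots in the closed field, and the parametrisation is
    multiplicative. *)
Lemma alg_torus_div (D : 'M[K]_2 -> Prop) : is_alg_torus D ->
  forall x, D x -> exists2 z, D z & x = z ^+ p.
Proof.
have p_gt0 := prime_gt0 p_pr.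
case=> _ [_ [n [f [P [Q [_ fM _ Df]]]]]] x /Df[t Gt ->].
have [r rE] : exists r : 'I_n -> K, forall i, r i ^+ p = t 0 i.
  have h i : exists s, s ^+ p == t 0 i.
    by have [s <-] := closed_root (t 0 i) p_gt0; exists s.
  by exists (fun i => xchoose (h i)) => i; apply/eqP/(xchooseP (h i)).
pose s k : 'rV[K]_n := \row_i r i ^+ k.
have Gs1 i : r i != 0 by have := Gt i; rewrite -rE expf_eq0 p_gt0.
have Gs k : Gm (s k) by move=> i; rewrite mxE expf_neq0.
have fX k : f (s k.+1) = f (s 1%N) ^+ k.+1.
  elim: k => [|k IH]; first by rewrite expr1.
  rewrite exprS -IH -[RHS]fM //; congr f; apply/rowP => i.
  by rewrite !mxE exprS expr1.
exists (f (s 1%N)); first by apply/Df; exists (s 1%N).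
have -> : t = s p by apply/rowP => i; rewrite mxE rE.
by have := fX p.-1; rewrite prednK.
Qed.

(* A nonscalar element with a double eigenvalue is not a p-th power of an
   element commuting with it, since p-th powers kill the nilpotent part. *)
Lemma alg_torus_sub_centralizer (D : 'M[K]_2 -> Prop) : is_alg_torus D ->
  exists y, [/\ \tr y = 0, y *m y = 1%:M & forall x, D x -> centralizer_torus y x].
Proof.
move=> torD; have dD : forall x, D x -> \det x = 1 by case: torD => _ [].
have [[x [Dx x0]]|nD] := boolp.pselect (exists x, D x /\ traceless x != 0); last first.
  (* If [D] consists of scalar matrices, every trace-zero involution will do. *)
  exists (diag_mx (\row_(i < 2) if i == 0 then 1 else -1)); split.
  - by rewrite trmx2E !mxE /= subrr.
  - by apply: mx2P; rewrite mulmx2E !mxE /=; ring.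
  - move=> x Dx; split; first exact: dD.
    have /eqP : traceless x == 0 by apply/negPn/negP => x0; apply: nD; exists x.
    by rewrite /traceless => /eqP; rewrite subr_eq0 => /eqP ->; rewrite scalar_mxC.
have tx := trace_traceless x two.
have cx z : D z -> z *m traceless x = traceless x *m z.
  by move=> Dz; apply: comm_traceless; apply: (alg_torus_comm torD).
have dx : \det (traceless x) != 0.
  apply/negP => /eqP dx; case/eqP: (x0).
  have [z Dz xE] := alg_torus_div torD Dx.
    have [b zE] := centralizer_traceless two tx x0 (cx z Dz).
  move: zE; set a := _ / _ => zE.
  have nil : traceless x * traceless x = 0.
    by have := traceless_sqr tx; rewrite dx oppr0 raddf0.
  have nilX k : (1 < k)%N -> traceless x ^+ k = 0.
    by move=> k1; rewrite -(subnK k1) exprD expr2 nil mulr0.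
  have pM : p \in [pchar 'M[K]_2] by rewrite pchar_lalg pchar_Fbar.
  have xs : x = (a ^+ p)%:M.
    rewrite xE zE.
    have := pFrobenius_autD_comm pM (x := a%:M) (y := b *: traceless x).
    rewrite !pFrobenius_autE => ->; last by rewrite /GRing.comm -[LHS]scalar_mxC.
    rewrite exprZn nilX ?prime_gt1 // scaler0 addr0.
    by rewrite -scalemx1 -[1%:M]/(1 : 'M[K]_2) exprZn expr1n scalemx1.
  rewrite /traceless [X in X - _]xs [X in \tr X]xs mxtrace_scalar.
  by rewrite -[_ *+ 2]mulr_natr mulfK // subrr.
(* The square of the traceless part is the scalar e^2, so dividing by e yields an involution. *)
have [e eE] := closed_root (- \det (traceless x)) (isT : (0 < 2)%N).
have e0 : e != 0 by apply: contraNneq dx => e0; rewrite -oppr_eq0 -eE e0 expr0n.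
exists (e^-1 *: traceless x); split.
- by rewrite mxtraceZ tx mulr0.
- rewrite -scalemxAl -scalemxAr traceless_sqr // -eE !scale_scalar_mx.
  by rewrite mulrA -invfM -expr2 mulVf // expf_neq0.
- by move=> z Dz; split; [exact: dD|rewrite -scalemxAr -scalemxAl cx].
Qed.

Lemma max_torus_centralizer (T : {group {'GL_2(p)}}) : is_max_torus T ->
  exists Y : 'M['F_p]_2, [/\ \tr Y = 0, \det Y != 0 &
    forall g : {'GL_2(p)}, (g \in T) = (g \in SL2 p) && (GLval g *m Y == Y *m GLval g)].
Proof.
case=> D [[torD maxD] defD TD].
have [y [tr0 yy Dy]] := alg_torus_sub_centralizer torD.
(* Maximality turns the inclusion of [D] in the centralizer torus into an equality. *)
have Dy' := maxD _ (centralizer_torus_alg two tr0 yy) Dy.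
have FD := @defined_over_Fp_Frob p p_pr D (proj1 torD) defD.
have y0 := involution_neq0 tr0 yy.
(* Since s^-1 = - s, the point of parameter s is s y. So a multiple of [y] lies in [D], its
   Frobenius image lies in [D] too, and this image commutes with [y]. *)
have [s sE] := @closed_root K 2 (-1) isT.
have s0 : s != 0 by apply: contra_eq_neq sE => ->; rewrite expr0n eq_sym oppr_eq0 oner_eq0.
have sV : s^-1 = - s by apply: (mulfI s0); rewrite divff // mulrN -expr2 sE opprK.
have xE : torus_param y s = s *: y.
  rewrite /torus_param sV subrr mul0r raddf0 add0r opprK; congr (_ *: _); by field.
have /FD/Dy[_] := Dy' _ (torus_param_centralizer two tr0 yy s0).
rewrite xE => Fy.
have [c cE] : exists c, Frob p_pr y = c *: y.
  apply: traceless_comm => //.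
    by rewrite /Frob trace_map_mx tr0 rmorph0.
  move: Fy; rewrite /Frob map_mxZ -scalemxAl -scalemxAr => /esym /scalerI; apply.
  by rewrite fmorph_eq0.
have c0 : c != 0.
  apply: contraNneq y0 => c0; move/eqP: cE; rewrite c0 scale0r.
  by rewrite map_mx_eq0.
have p1 : (0 < p.-1)%N by rewrite -subn1 subn_gt0 prime_gt1.
(* From e^(p-1) = c^-1 follows e^p c = e, which makes e y fixed by Frobenius. *)
have [e eE] := closed_root c^-1 p1.
have e0 : e != 0 by apply: contra_eq_neq eE => ->; rewrite expr0n gtn_eqF // eq_sym invr_eq0.
have [Y YE] : exists N : 'M['F_p]_2, e *: y = map_mx (toFbar p) N.
  have Fe : pFrobenius_aut (pchar_Fbar p_pr) e * c = e.
    have := exprS e p.-1; rewrite prednK ?prime_gt0 // eE => ep.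
    by rewrite pFrobenius_autE ep mulfVK.
  have := @Frob_fixed _ p_pr (e *: y); apply.
  by rewrite /Frob map_mxZ [map_mx _ _]cE scalerA; congr (_ *: _).
exists Y; split.
- apply: (fmorph_inj (toFbar p)); by rewrite -trace_map_mx -YE mxtraceZ tr0 mulr0 rmorph0.
- rewrite -(fmorph_eq0 (toFbar p)) -det_map_mx -YE detZ mulf_neq0 ?expf_neq0 //.
  by rewrite (det_involution tr0 yy) oppr_eq0 oner_eq0.
- move=> g; have gc : (GLval g *m Y == Y *m GLval g) <->
     map_mx (toFbar p) (GLval g) *m y = y *m map_mx (toFbar p) (GLval g).
    have -> : (GLval g *m Y == Y *m GLval g) =
        (map_mx (toFbar p) (GLval g *m Y) == map_mx (toFbar p) (Y *m GLval g)).
      by apply/eqP/eqP => [->|/map_mx_inj].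
    rewrite !map_mxM -YE -scalemxAl -scalemxAr.
    by split=> [/eqP/(scalerI e0)|->].
  apply/idP/idP => [/TD[-> /Dy[_]]|/andP[gS /gc h]]; first by move/gc.
  apply/TD; split=> //; apply: Dy'; split=> //.
  by move: gS; rewrite inE det_map_mx => /eqP ->; rewrite rmorph1.
Qed.
End MaximalTori.

(** * The torus as a cyclic group *)

(* The conic is parametrised by the slopes of the lines through (1, 0). *)
Lemma card_conic (F : finFieldType) (delta : F) : 2%:R != 0 :> F ->
  (forall e, e ^+ 2 != delta) ->
  #|[set u : F * F | u.1 ^+ 2 - delta * u.2 ^+ 2 == 1]| = #|F|.+1.
Proof.
move=> two nsq.
have d0 : delta != 0 by have := nsq 0; rewrite expr0n eq_sym.
have nd m : m ^+ 2 - delta != 0 by rewrite subr_eq0.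
pose phi (m : option F) := if m is Some m then
  ((m ^+ 2 + delta) / (m ^+ 2 - delta), 2%:R * m / (m ^+ 2 - delta)) else (1, 0).
pose phi' (u : F * F) := if u.1 == 1 then None else Some (delta * u.2 / (u.1 - 1)).
have a1 m : (m ^+ 2 + delta) / (m ^+ 2 - delta) - 1 = 2%:R * delta / (m ^+ 2 - delta).
  by field.
have phiK : cancel phi phi'.
  case=> [m|]; rewrite /phi /phi' /= ?eqxx //.
  rewrite -subr_eq0 a1 ifN; last by rewrite !mulf_neq0 ?invr_eq0.
  by congr Some; field; rewrite two d0 nd.
rewrite -(card_option F) -(card_imset predT (can_inj phiK)).
apply: eq_card => -[a b]; rewrite inE /=; apply/eqP/imsetP => [ab|[[m|] _ [-> ->]]].
- exists (phi' (a, b)) => //; rewrite /phi' /phi /=; case: eqVneq => [a1'|an].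
    move: ab; rewrite a1' expr1n -[RHS]subr0 => /addrI/oppr_inj/eqP.
    by rewrite mulf_eq0 (negPf d0) expf_eq0 /= => /eqP ->.
  have an' : a - 1 != 0 by rewrite subr_eq0.
  have E : (delta * b / (a - 1)) ^+ 2 - delta = 2%:R * delta / (a - 1).
    have e : (delta * b) ^+ 2 = delta * (a ^+ 2 - 1) by rewrite -ab; ring.
    by rewrite expr_div_n e; field.
  rewrite E; congr (_, _); last by field; rewrite an' d0 two.
  apply: (@mulIf _ (2%:R * delta / (a - 1))); first by rewrite !mulf_neq0 ?invr_eq0.
  rewrite mulfVK; last by rewrite !mulf_neq0 ?invr_eq0.
  have -> : (delta * b / (a - 1)) ^+ 2 = 2%:R * delta / (a - 1) + delta by rewrite -E subrK.
  by field.
- by field.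
- by rewrite expr0n mulr0 subr0 expr1n.
Qed.

(** Since y^2 = 1, the rows of y + 1 and y - 1 are left eigenvectors for 1 and -1. One row of each
    makes up h, and rescaling its first row gives determinant 1. *)
Lemma diagonalize_involution (F : fieldType) (y : 'M[F]_2) : 2%:R != 0 :> F ->
  \tr y = 0 -> \det y = -1 ->
  exists2 h, \det h = 1 & h *m y = diag_mx (\row_(i < 2) if i == 0 then 1 else -1) *m h.
Proof.
move=> two.
suff H : \tr y = 0 -> \det y = -1 -> exists2 h, \det h != 0 &
    h *m y = diag_mx (\row_(i < 2) if i == 0 then 1 else -1) *m h.
  move=> t d; have [h h0 hy] := H t d.
  exists (diag_mx (\row_(i < 2) if i == 0 then (\det h)^-1 else 1) *m h).
    by rewrite det_mulmx det_diag !big_ord_recl big_ord0 !mxE /= !mulr1 mulVf.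
  by rewrite -mulmxA hy !mulmxA; congr (_ *m _); rewrite diag_mxC.
rewrite trmx2E detmx2E => /eqP; rewrite addrC addr_eq0 => /eqP y11.
set a := y 0 0 in y11 *; set b := y 0 1; set c := y 1 0; rewrite y11 => dy.
have bc : b * c = 1 - a ^+ 2.
  by transitivity (- (a * - a - b * c) - a ^+ 2); [ring|rewrite dy opprK].
(* The first row of y + 1 and the second of y - 1 have determinant -2(1 + a). When 1 + a = 0, the
   second row of y + 1 and the first of y - 1 are taken instead, with determinant 4. *)
have [a1|a1] := eqVneq (1 + a) 0.
  have aE : a = -1 by apply/eqP; rewrite -addr_eq0 addrC a1.
  have bc0 : b * c = 0 by rewrite bc aE sqrrN expr1n subrr.
  exists (\matrix_(i, j) if i == 0 then (if j == 0 then c else 2%:R)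
     else if j == 0 then -2%:R else b).
    by rewrite detmx2E !mxE /= mulrC bc0 add0r mulrN opprK mulf_neq0.
  by apply: mx2P; rewrite !mulmx2E !mxE /= -/a -/b -/c ?y11 aE !mulr0n !mulr1n;
    rewrite ?[c * b]mulrC ?bc0; ring.
exists (\matrix_(i, j) if i == 0 then (if j == 0 then 1 + a else b)
     else if j == 0 then c else - a - 1).
  rewrite detmx2E !mxE /= bc.
  have -> : (1 + a) * (- a - 1) - (1 - a ^+ 2) = - (2%:R * (1 + a)) by ring.
  by rewrite oppr_eq0 mulf_neq0.
apply: mx2P; rewrite !mulmx2E !mxE /= -/a -/b -/c ?y11 !mulr0n !mulr1n ?[c * b]mulrC ?bc; ring.
Qed.

Lemma GL_exists (p : nat) (M : 'M['F_p]_2) : \det M != 0 ->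
  exists g : {'GL_2(p)}, GLval g = M.
Proof.
move=> dM; have uM : M \is a GRing.unit by rewrite [_ \is a _]unitmxE unitfE.
by exists (FinRing.unit _ uM).
Qed.

Section CentralizerGroup.
Variables (p : nat) (p_pr : prime p) (two : 2%:R != 0 :> 'F_p).
Variables (T : {group {'GL_2(p)}}) (Y : 'M['F_p]_2).
Hypotheses (trY : \tr Y = 0) (dY : \det Y != 0).
Hypothesis TE : forall g : {'GL_2(p)},
  (g \in T) = (g \in SL2 p) && (GLval g *m Y == Y *m GLval g).

Let Y0 : Y != 0.
Proof. by apply: contraNneq dY => ->; rewrite det0. Qed.

(** [re_part] and [im_part] are the coordinates along 1 and [Y], read off by traces; the sign in the
    second comes from tr(Y^2) = -2 det Y. *)
Definition re_part (M : 'M['F_p]_2) := \tr M / 2%:R.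
Definition im_part (M : 'M['F_p]_2) := - (\tr (M *m Y) / (2%:R * \det Y)).

Lemma re_partE a b : re_part (a%:M + b *: Y) = a.
Proof.
by rewrite /re_part mxtraceD mxtraceZ trY mulr0 addr0 mxtrace_scalar -[a *+ 2]mulr_natr mulfK.
Qed.

Lemma im_partE a b : im_part (a%:M + b *: Y) = b.
Proof.
rewrite /im_part mulmxDl mxtraceD -scalemxAl mul_scalar_mx !mxtraceZ trY mulr0 add0r.
rewrite traceless_sqr // mxtrace_scalar -[_ *+ 2]mulr_natr.
by field; rewrite dY two.
Qed.

Lemma torus_coord g : g \in T -> exists a b,
  GLval g = a%:M + b *: Y /\ a ^+ 2 + b ^+ 2 * \det Y = 1.
Proof.
rewrite TE inE => /andP[/eqP dg /eqP gY].
have [b gE] := centralizer_traceless two trY Y0 gY.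
by exists (\tr (GLval g) / 2%:R), b; split=> //; rewrite -det_centralizer // -gE.
Qed.

Lemma torus_mem (g : {'GL_2(p)}) a b : GLval g = a%:M + b *: Y ->
  a ^+ 2 + b ^+ 2 * \det Y = 1 -> g \in T.
Proof.
move=> gE ab; rewrite TE inE gE det_centralizer // ab eqxx /=.
by rewrite mulmxDl mulmxDr -scalemxAl -scalemxAr scalar_mxC.
Qed.

(** For g = a + b Y of determinant 1, det(g - 1) = 2 - 2a. If this vanishes then a = 1, and the norm
    equation leaves b = 0. *)
Lemma torus_sub1_unit g : g \in T -> g != 1%g -> GLval g - 1%:M \in unitmx.
Proof.
move=> /torus_coord[a [b [gE ab]]]; apply: contraR.
rewrite unitmxE unitfE negbK gE addrAC -raddfB /= det_centralizer // => /eqP ab'.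
have a1 : a = 1.
  apply: (mulfI two); transitivity
    ((a ^+ 2 + b ^+ 2 * \det Y) - ((a - 1) ^+ 2 + b ^+ 2 * \det Y) + 1); first by ring.
  by rewrite ab ab' subr0 mulr1.
have b0 : b = 0.
  apply/eqP; move/eqP: ab; rewrite a1 expr1n -subr_eq0 addrAC subrr add0r.
  by rewrite mulf_eq0 (negPf dY) orbF expf_eq0.
by apply/eqP/val_inj; rewrite /= [LHS]gE a1 b0 scale0r addr0.
Qed.

(** With e a square root of - det Y in [K], the eigenvalue a + b e of a + b Y embeds [T] into the
    units of a field. Injectivity holds because a - b e is the inverse eigenvalue, so both equal 1
    together. *)
Lemma torus_cyclic (K : closedFieldType) (iota : {rmorphism 'F_p -> K}) : cyclic T.
Proof.
have [e [eE e0]] : exists e : K, e ^+ 2 = iota (- \det Y) /\ e != 0.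
  have [e eE] := @closed_root K 2 (iota (- \det Y)) isT.
  exists e; split=> //; apply: contraNneq dY => e0.
  by move/eqP: eE; rewrite e0 expr0n eq_sym fmorph_eq0 oppr_eq0.
have twoK : 2%:R != 0 :> K by rewrite -(rmorph_nat iota) fmorph_eq0.
pose f (g : {'GL_2(p)}) : K := iota (re_part (GLval g)) + iota (im_part (GLval g)) * e.
have fE (g : {'GL_2(p)}) a b : GLval g = a%:M + b *: Y -> f g = iota a + iota b * e.
  by move=> gE; rewrite /f gE re_partE im_partE.
apply: (@field_mul_group_cyclic _ _ _ f) => [g h gT hT|g gT].
  have [a [b [gE ab]]] := torus_coord gT; have [c [d [hE cd]]] := torus_coord hT.
  rewrite (fE _ _ _ gE) (fE _ _ _ hE).
  rewrite (fE _ (a * c - b * d * \det Y) (a * d + b * c)).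
    rewrite rmorphB !rmorphD !rmorphM -[\det Y]opprK rmorphN -eE.
    by ring.
  by rewrite GL_MxE gE hE mul_centralizer.
have [a [b [gE ab]]] := torus_coord gT; split=> [|->]; last first.
  by rewrite (fE _ 1 0) ?rmorph1 ?rmorph0 ?mul0r ?addr0 // GL_1E scale0r addr0.
rewrite (fE _ _ _ gE) => u1.
have uv : (iota a + iota b * e) * (iota a - iota b * e) = 1.
  have -> : 1 = iota (a ^+ 2 + b ^+ 2 * \det Y) by rewrite ab rmorph1.
  by rewrite rmorphD !rmorphM -[\det Y]opprK rmorphN -eE; ring.
have v1 : iota a - iota b * e = 1 by rewrite -uv u1 mul1r.
have a1 : a = 1.
  apply: (fmorph_inj iota); rewrite rmorph1; apply: (mulfI twoK).
  transitivity ((iota a + iota b * e) + (iota a - iota b * e)); first by ring.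
  by rewrite u1 v1 mulr1.
have b0 : b = 0.
  apply/eqP; move/eqP: u1.
  by rewrite a1 rmorph1 -subr_eq0 addrAC subrr add0r mulf_eq0 (negPf e0) orbF fmorph_eq0.
by apply/val_inj; rewrite /= [LHS]gE a1 b0 scale0r addr0.
Qed.

Lemma card_diag_torus : #|diag_torus p| = p.-1.
Proof.
pose D (a : 'F_p) : 'M_2 := diag_mx (\row_(i < 2) if i == 0 then a else a^-1).
have DE a i j : D a i j = if i == j then (if i == 0 then a else a^-1) else 0.
  by rewrite !mxE; case: (i == j).
have dD a : a != 0 -> \det (D a) = 1.
  by move=> a0; rewrite det_diag !big_ord_recl big_ord0 !mxE /= mulr1 divff.
have -> : p.-1 = #|[set~ (0 : 'F_p)]| by rewrite cardsC1 card_Fp.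
rewrite -(card_in_imset (f := fun g : {'GL_2(p)} => GLval g 0 0) (D := mem (diag_torus p))).
  apply: eq_card => a; rewrite !inE; apply/imsetP/idP => [[g]|a0].
    by rewrite inE => /existsP[b /andP[b0 /eqP ->]] ->; rewrite [diag_mx _ _ _]DE.
  have [|g gE] := @GL_exists p (D a); first by rewrite dD ?oner_neq0.
  exists g; last by rewrite gE DE.
  by rewrite inE; apply/existsP; exists a; rewrite a0 gE eqxx.
move=> g h; rewrite !inE => /existsP[a /andP[a0 /eqP gE]] /existsP[b /andP[b0 /eqP hE]].
rewrite gE hE [LHS]DE [RHS]DE /= => ab.
by apply/val_inj; rewrite /= [LHS]gE [RHS]hE ab.
Qed.

(** The involution e^-1 Y is diagonalized over F_p by a matrix of determinant 1, which conjugates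
    [T] into the centralizer of diag(1, -1) in SL_2, the diagonal torus. *)
Lemma split_of_square e : e ^+ 2 = - \det Y -> is_split_torus T.
Proof.
move=> eE; have e0 : e != 0.
  by apply: contraNneq dY => e0; rewrite -oppr_eq0 -eE e0 expr0n.
have [||h dh hy] := @diagonalize_involution _ (e^-1 *: Y) two.
- by rewrite mxtraceZ trY mulr0.
- by rewrite detZ -[\det Y]opprK -eE mulrN -exprMn mulVf // expr1n.
have [|x xE] := @GL_exists p h; first by rewrite dh oner_neq0.
have xS : x \in SL2 p by rewrite inE xE dh.
exists x => //; apply/setP => g; rewrite mem_conjg.
pose J : 'M['F_p]_2 := diag_mx (\row_(i < 2) if i == 0 then 1 else -1).
have hY : h *m Y = e *: (J *m h).
  by rewrite -hy -scalemxAr scalerA divff // scale1r.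
have [k gE] : exists k, g = (k ^ x)%g by exists (g ^ x^-1)%g; rewrite conjgKV.
have -> : (g ^ x^-1)%g = k by rewrite gE conjgK.
have kx : GLval k *m h = h *m GLval g.
  have kxg : (k * x = x * g)%g by rewrite conjgC -gE.
  by have := congr1 (@GLval 2 _) kxg; rewrite !GL_MxE xE.
have gk : (g \in SL2 p) = (k \in SL2 p) by rewrite gE groupJr.
have uh : h \in unitmx by rewrite unitmxE dh unitr1.
have kJ : (GLval g *m Y == Y *m GLval g) = (GLval k *m J == J *m GLval k).
  apply/eqP/eqP => [gY|kJ].
    apply: (can_inj (mulmxK uh)); apply: (scalerI e0).
    transitivity (GLval k *m (h *m Y)); first by rewrite hY -scalemxAr mulmxA.
    by rewrite mulmxA kx -mulmxA gY mulmxA hY -scalemxAl -[J *m h *m _]mulmxA -kx mulmxA.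
  apply: (can_inj (mulKmx uh)).
  rewrite [LHS]mulmxA -kx -mulmxA hY -scalemxAr mulmxA kJ.
  by rewrite [RHS]mulmxA hY -scalemxAl -!mulmxA -kx.
rewrite TE gk kJ !inE detmx2E; set M := GLval k; apply/andP/existsP => [[/eqP dM /eqP MJ]|].
  have M01 : M 0 1 = 0.
    have := congr1 (fun N : 'M_2 => N 0 1) MJ; rewrite !mulmx2E !mxE /= !mulr0n !mulr1n.
    move/eqP; rewrite -subr_eq0 => /eqP E; apply/eqP; rewrite -(mulrI_eq0 _ (mulfI two)) -oppr_eq0.
    by apply/eqP; rewrite -[RHS]E; ring.
  have M10 : M 1 0 = 0.
    have := congr1 (fun N : 'M_2 => N 1 0) MJ; rewrite !mulmx2E !mxE /= !mulr0n !mulr1n.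
    move/eqP; rewrite -subr_eq0 => /eqP E; apply/eqP; rewrite -(mulrI_eq0 _ (mulfI two)).
    by apply/eqP; rewrite -[RHS]E; ring.
  move: dM; rewrite M01 mul0r subr0 => dM.
  have a0 : M 0 0 != 0 by apply: contra_eq_neq dM => ->; rewrite mul0r eq_sym oner_neq0.
  exists (M 0 0); rewrite a0; apply/eqP/mx2P; rewrite !mxE //=.
  by apply: (mulfI a0); rewrite dM divff.
case=> a /andP[a0 /eqP ->]; split.
  by rewrite !mxE /= !mulr0n !mulr1n mulfV ?mul0r ?subr0.
by rewrite diag_mxC.
Qed.

Lemma card_split_torus : is_split_torus T -> #|T| = p.-1.
Proof. by case=> x _ ->; rewrite cardJg card_diag_torus. Qed.

(** The coordinates along 1 and [Y] identify [T] with the conic a^2 - delta b^2 = 1 for delta = -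
    det Y, which is not a square by [split_of_square]. *)
Lemma card_nonsplit_torus : ~ is_split_torus T -> #|T| = p.+1.
Proof.
move=> nsT; pose c (g : {'GL_2(p)}) := (re_part (GLval g), im_part (GLval g)).
have nsq e : e ^+ 2 != - \det Y by apply/eqP => /split_of_square.
have := card_conic two nsq; rewrite card_Fp // => <-.
have cE (g : {'GL_2(p)}) a b : GLval g = a%:M + b *: Y -> c g = (a, b).
  by move=> gE; rewrite /c gE re_partE im_partE.
rewrite -(card_in_imset (f := c)); last first.
  move=> g h /torus_coord[a [b [gE _]]] /torus_coord[a' [b' [hE _]]].
  rewrite (cE _ _ _ gE) (cE _ _ _ hE) => -[aE bE].
  by apply/val_inj; rewrite /= [LHS]gE aE bE.
apply: eq_card => -[a b]; rewrite inE /= mulNr opprK [_ * b ^+ 2]mulrC.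
apply/imsetP/eqP => [[g /torus_coord[a' [b' [gE ab]]]]|ab].
  by rewrite (cE _ _ _ gE) => -[-> ->].
have [|g gE] := @GL_exists p (a%:M + b *: Y).
  by rewrite det_centralizer // ab oner_neq0.
by exists g; [apply: torus_mem gE ab|rewrite (cE _ _ _ gE)].
Qed.

End CentralizerGroup.

(** * Matrices of the Weil representation *)

Section OperatorMatrices.
Import VectorInternalTheory.
Variables (R : realType) (p : nat).
Local Notation C := R[i].
Local Notation N := (Zp_trunc (pdiv p)).+2.
Local Notation H := (Hilb R p).
Local Notation toH := (@r2v _ H).
Local Notation toV := (@v2r _ H).

Definition delta_fun (i : 'F_p) : H := [ffun y => (y == i)%:R].

(** Row i is the image of [delta_fun i], so composition corresponds to the product in reverse order.
    Here 'F_p is the ordinal type of size [N], whence its elements index rows and columns. *)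
Definition opmx (u : 'End(H)) : 'M[C]_N :=
  \matrix_(i < N, j < N) (u (delta_fun i) j : C).

Lemma hilb_expand (f : H) : f = \sum_i (f i : C) *: delta_fun i.
Proof.
apply/ffunP => x.
have fE i : ((f i : C) *: delta_fun i : H) x = (f i : C) * (x == i)%:R :> C.
  by rewrite !ffunE.
rewrite sum_ffunE; under eq_bigr do rewrite fE.
rewrite (bigD1 x) //= eqxx mulr1 big1 ?addr0 // => i ix.
by rewrite eq_sym (negPf ix) mulr0.
Qed.

Lemma opmx_comp (u v : 'End(H)) : opmx (u \o v)%VF = opmx v *m opmx u.
Proof.
apply/matrixP => i j; rewrite !mxE comp_lfunE (hilb_expand (v _)) linear_sum sum_ffunE.
by apply: eq_bigr => k _; rewrite linearZ !ffunE !mxE.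
Qed.

Lemma opmx1 : opmx \1%VF = 1%:M.
Proof. by apply/matrixP => i j; rewrite !mxE id_lfunE ffunE eq_sym. Qed.

Lemma opmxB_scale (u : 'End(H)) (a : C) : opmx (u - a *: \1%VF)%VF = opmx u - a%:M.
Proof.
apply/matrixP => i j; rewrite !mxE add_lfunE opp_lfunE scale_lfunE id_lfunE !ffunE.
by rewrite eq_sym /GRing.scale /= mulr_natr.
Qed.

(** Dimensions of subspaces are computed in an internal basis. [E] and [E'] are the mutually inverse
    changes between it and the delta functions, and they preserve the rank. *)
Lemma dim_lker_opmx (u : 'End(H)) : \dim (lker u) = (N - \rank (opmx u))%N.
Proof.
pose n := dim H.
pose E : 'M[C]_(N, n) := \matrix_(i < N) toV (delta_fun i).
pose E' : 'M[C]_(n, N) := \matrix_(i < n, j < N) (toH (delta_mx 0 i) : {ffun 'F_p -> C^o}) j.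
have EE' : E' *m E = 1%:M.
  apply/row_matrixP => i; rewrite row_mul row1.
  have rE' k : toH (delta_mx 0 k) = \sum_j E' k j *: delta_fun j.
    by rewrite [LHS]hilb_expand; apply: eq_bigr => j _; rewrite mxE.
  rewrite -[RHS](@r2vK _ H) rE' linear_sum mulmx_sum_row; apply: eq_bigr => j _.
  by rewrite linearZ rowK !mxE.
have E'E : E *m E' = 1%:M.
  apply/matrixP => i j; rewrite !mxE.
  transitivity (delta_fun i j : C); last by rewrite ffunE eq_sym.
  rewrite -[delta_fun i](@v2rK _ H) [toV _]row_sum_delta linear_sum sum_ffunE.
  by apply: eq_bigr => k _; rewrite linearZ ffunE !mxE.
have uE : E *m f2mx u = opmx u *m E.
  apply/row_matrixP => i; rewrite !row_mul rowK.
  have <- : toV (u (delta_fun i)) = toV (delta_fun i) *m f2mx u.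
    by move: (delta_fun i) => f; rewrite unlock /= r2vK.
  rewrite [u _]hilb_expand linear_sum mulmx_sum_row; apply: eq_bigr => j _.
  by rewrite linearZ rowK !mxE.
have uE' : f2mx u = E' *m opmx u *m E by rewrite -mulmxA -uE mulmxA EE' mul1mx.
have uE'' : opmx u = E *m f2mx u *m E' by rewrite uE -mulmxA E'E mulmx1.
have leN (k l : nat) (M : 'M[C]_(k, l)) (M' : 'M[C]_(l, k)) : M *m M' = 1%:M -> (k <= l)%N.
  by move=> MM; rewrite -(mxrank1 C k) -MM (leq_trans (mxrankM_maxl _ _)) ?rank_leq_col.
have nN : n = N by apply/eqP; rewrite eqn_leq (leN _ _ _ _ EE') (leN _ _ _ _ E'E).
have rE : \rank (f2mx u) = \rank (opmx u).
  apply/eqP; rewrite eqn_leq; apply/andP; split.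
    by rewrite uE' (leq_trans (mxrankM_maxl _ _)) ?mxrankM_maxr.
  by rewrite uE'' (leq_trans (mxrankM_maxl _ _)) ?mxrankM_maxr.
rewrite /dimv /lker mx2vsK mxrank_ker rE; congr (_ - _)%N.
exact: nN.
Qed.
End OperatorMatrices.

(** * Traces of Heisenberg operators and averaging over their conjugations *)

Section Twirl.
Variables (R : realType) (p : nat) (p_pr : prime p) (p_odd : odd p).
Local Notation C := R[i].
Local Notation N := (Zp_trunc (pdiv p)).+2.

Lemma psi1_neq1 : psi R (1 : 'F_p) != 1.
Proof.
(* This puts the angle 2 pi / p strictly between 0 and pi, where the sine is positive. *)
have p2 : (2 < p)%N.
  by rewrite ltn_neqAle prime_gt1 // andbT; apply/eqP => p2; move: p_odd; rewrite -p2.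
have pp : 0 < p%:R :> R by rewrite ltr0n prime_gt0.
apply/eqP => /eqP; rewrite eq_complex /= => /andP[_ /eqP].
rewrite modn_small //.
rewrite mulr1; apply/eqP; rewrite gt_eqF // sin_gt0_pi //.
rewrite divr_gt0 ?mulr_gt0 ?pi_gt0 //= ltr_pdivrMr // mulrC ltr_pM2l ?pi_gt0 //.
by rewrite ltr_nat.
Qed.

(** For a != 0, shifting w by a^-1 multiplies the sum by psi(1) != 1. *)
Lemma sum_psi (a : 'F_p) : \sum_(w : 'F_p) psi R (w * a) = (a == 0)%:R * p%:R.
Proof.
have [->|a0] := eqVneq a 0.
  under eq_bigr do rewrite mulr0 psi0.
  by rewrite sumr_const card_Fp // mul1r.
rewrite mul0r; set S := (X in X = _).
have : psi R (1 : 'F_p) * S = S.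
  rewrite /S mulr_sumr [RHS](reindex_inj (addIr a^-1)); apply: eq_bigr => w _ /=.
  by rewrite -psiD // mulrDl mulVf // addrC.
move/eqP; rewrite -subr_eq0 -[X in _ - X]mul1r -mulrBl mulf_eq0 subr_eq0.
by rewrite (negPf psi1_neq1) => /eqP.
Qed.

Lemma opmx_heisE (h : heis p) i j :
  opmx (heis_rep R h) i j =
  psi R (h.2 + 2%:R^-1 * (h.1 0 0 * h.1 1 0) + h.1 1 0 * j) * (j + h.1 0 0 == i)%:R.
Proof. by rewrite mxE lfunE /= !ffunE. Qed.

Lemma trace_opmx_heis (h : heis p) :
  \tr (opmx (heis_rep R h)) = psi R h.2 * (h.1 == 0)%:R * p%:R.
Proof.
case: h => v z /=; rewrite /mxtrace.
under eq_bigr do rewrite opmx_heisE /= -[X in _ == X]addr0 (inj_eq (addrI _)).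
have v0 : (v == 0) = (v 0 0 == 0) && (v 1 0 == 0).
  apply/eqP/andP => [->|[/eqP a /eqP b]]; first by rewrite !mxE.
  apply/colP => i; rewrite mxE; case: i => [[|[|//]] lti]; [rewrite -[RHS]a|rewrite -[RHS]b];
    by congr (v _ _); apply/val_inj.
rewrite v0; have [t0|_] := eqVneq (v 0 0) 0; last first.
  by rewrite mulr0 mul0r big1 // => i _; rewrite mulr0.
transitivity (psi R z * \sum_i psi R (i * v 1 0)); last by rewrite sum_psi mulrA.
rewrite mulr_sumr; apply: eq_bigr => i _.
by rewrite mulr1 t0 -psiD // mul0r mulr0 addr0 mulrC.
Qed.

(** An explicit form of Schur's lemma for the Heisenberg representation: the sum over the modulation
    w kills the off-diagonal entries, and the sum over the translation t turns each diagonal entry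
    into the trace. *)
Lemma twirl (X : 'M[C]_N) :
  \sum_(v : 'cV['F_p]_2) opmx (heis_rep R (- v, 0)) *m X *m opmx (heis_rep R (v, 0))
  = (p%:R * \tr X)%:M.
Proof.
pose f (u : 'F_p * 'F_p) := vec2 u.1 u.2.
have f_bij : bijective f.
  exists (fun v : 'cV['F_p]_2 => (v 0 0, v 1 0)) => [[t w]|v]; first by rewrite !mxE.
  apply/colP => i; rewrite !mxE; case: i => [[|[|//]] lti] /=;
    by congr (v _ _); apply/val_inj.
rewrite (reindex f) /=; last exact: onW_bij.
rewrite -(pair_bigA _ (fun t w => opmx (heis_rep R (- vec2 t w, 0)) *m X *m
   opmx (heis_rep R (vec2 t w, 0)))) /=.
have E t w i j : (opmx (heis_rep R (- vec2 t w, 0)) *m X *m opmx (heis_rep R (vec2 t w, 0))) i j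
   = psi R (w * (j - i)) * X (i + t) (j + t).
  rewrite mxE (bigD1 (j + t)) //= big1 => [|l lj]; last first.
    by rewrite opmx_heisE !mxE /= eq_sym (negPf lj) !mulr0.
  rewrite addr0 opmx_heisE /= !mxE /= eqxx mulr1 (bigD1 (i + t)) //= big1 => [|k ki]; last first.
    by rewrite opmx_heisE !mxE /= subr_eq (negPf ki) mulr0 mul0r.
  rewrite addr0 opmx_heisE !mxE /= addrK eqxx mulr1 mulrAC -psiD //; congr (psi _ _ * _).
  have two := two_neq0_Fp p_pr p_odd.
  by field.
apply/matrixP => i j; rewrite summxE !mxE.
under eq_bigr do (rewrite summxE; under eq_bigr do rewrite E; rewrite -mulr_suml sum_psi).
rewrite -mulr_sumr subr_eq0 eq_sym; have [->|_] := eqVneq i j; last by rewrite !mul0r.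
rewrite mul1r; congr (_ * _); rewrite /mxtrace [RHS](reindex_inj (addrI j)).
by [].
Qed.
End Twirl.

(** * Generation of SL_2(F_p) by elements of order dividing p *)

Section UnipotentGeneration.
Variables (p : nat) (p_pr : prime p).

Lemma unipotent_expgn (g : {'GL_2(p)}) :
  (GLval g - 1%:M) *m (GLval g - 1%:M) = 0 -> (g ^+ p)%g = 1%g.
Proof.
set n := GLval g - 1%:M => nn; apply: val_inj; rewrite FinRing.val_unitX /=.
have -> : FinRing.uval g = n + 1 by rewrite /n subrK.
have pM : p \in [pchar 'M['F_p]_2] by rewrite pchar_lalg pchar_Fp.
have := pFrobenius_autD_comm pM (commr1 n).
rewrite !pFrobenius_autE expr1n => ->.
have nX k : (1 < k)%N -> n ^+ k = 0.
  by move=> k1; rewrite -(subnK k1) exprD expr2 [n * n]nn mulr0.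
by rewrite nX ?prime_gt1 // add0r.
Qed.

Lemma SL2_unipotent_ind (P : {'GL_2(p)} -> Prop) :
  (forall g, g \in SL2 p -> (g ^+ p)%g = 1%g -> P g) ->
  {in SL2 p &, forall g h, P g -> P h -> P (g * h)%g} ->
  {in SL2 p, forall g, P g}.
Proof.
move=> Pu PM.
pose mx a b c d : 'M['F_p]_2 := \matrix_(i, j)
  if i == 0 then (if j == 0 then a else b) else if j == 0 then c else d.
have eU x : exists2 g : {'GL_2(p)}, g \in SL2 p /\ P g & GLval g = mx 1 x 0 1.
  have d1 : \det (mx 1 x 0 1) = 1 by rewrite detmx2E !mxE /= mulr0 subr0 mulr1.
  have [|g gE] := @GL_exists p (mx 1 x 0 1); first by rewrite d1 oner_neq0.
  have gS : g \in SL2 p by rewrite inE gE d1.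
  exists g => //; split=> //; apply: Pu => //; apply: unipotent_expgn.
  by rewrite gE; apply: mx2P; rewrite !mulmx2E !mxE /=; ring.
have eL x : exists2 g : {'GL_2(p)}, g \in SL2 p /\ P g & GLval g = mx 1 0 x 1.
  have d1 : \det (mx 1 0 x 1) = 1 by rewrite detmx2E !mxE /= mul0r subr0 mulr1.
  have [|g gE] := @GL_exists p (mx 1 0 x 1); first by rewrite d1 oner_neq0.
  have gS : g \in SL2 p by rewrite inE gE d1.
  exists g => //; split=> //; apply: Pu => //; apply: unipotent_expgn.
  by rewrite gE; apply: mx2P; rewrite !mulmx2E !mxE /=; ring.
have Pc g : g \in SL2 p -> GLval g 1 0 != 0 -> P g.
  rewrite inE detmx2E => /eqP dg c0; set a := GLval g 0 0 in dg *.
  set b := GLval g 0 1 in dg *; set c := GLval g 1 0 in dg c0 *; set d := GLval g 1 1 in dg *.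
  (* When c != 0, g is upper times lower times upper unipotent. The parameters are forced by the
     entries c, a and d, and the entry b follows from the determinant. *)
  have [u1 [u1S Pu1] u1E] := eU ((a - 1) / c); have [l [lS Pl] lE] := eL c.
  have [u2 [u2S Pu2] u2E] := eU ((d - 1) / c).
  have -> : g = (u1 * l * u2)%g.
    apply/val_inj; rewrite -[LHS]/(GLval g) -[RHS]/(GLval (u1 * l * u2)%g) !GL_MxE.
    have bE : b = (a * d - 1) / c by apply: (mulIf c0); rewrite mulfVK // -dg; ring.
    by rewrite u1E lE u2E; apply: mx2P; rewrite !mulmx2E !mxE /= -/a -/b -/c -/d ?bE; field.
  by apply: (PM); rewrite ?groupM //; apply: (PM).
move=> g gS; have [c0|/Pc] := eqVneq (GLval g 1 0) 0; last exact.
(* When c = 0, the product l' g has lower left entry a, which is nonzero because a d = 1. *)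
have [l [lS Pl] lE] := eL (-1); have [l' [l'S Pl'] l'E] := eL 1.
have -> : g = (l * (l' * g))%g.
  suff ll' : (l * l')%g = 1%g by rewrite mulgA ll' mul1g.
  apply: val_inj; rewrite -[LHS]/(GLval (l * l')%g) GL_MxE.
  by rewrite lE l'E; apply: mx2P; rewrite !mulmx2E !mxE /=; ring.
apply: PM; rewrite ?groupM //; apply: Pc; rewrite ?groupM //.
rewrite GL_MxE l'E mulmx2E !mxE /= c0 mul1r mulr0 addr0.
move: gS; rewrite inE detmx2E c0 mulr0 subr0; apply: contraTneq => ->.
by rewrite mul0r eq_sym oner_neq0.
Qed.
End UnipotentGeneration.

Section WeilMatrices.
Variables (R : realType) (p : nat) (p_pr : prime p) (p_odd : odd p).
Variables (rho : {'GL_2(p)} -> 'End(Hilb R p)) (rho_weil : is_weil_rep rho).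
Local Notation W g := (opmx (rho g)).

Lemma weil_mxM : {in SL2 p &, forall g h, W (g * h)%g = W h *m W g}.
Proof. by move=> g h gS hS; rewrite (weilM rho_weil) // opmx_comp. Qed.

Lemma weil_mxV g : g \in SL2 p -> W g *m W g^-1%g = 1%:M.
Proof.
by move=> gS; rewrite -weil_mxM ?groupV // mulVg (weil1 rho_weil) opmx1.
Qed.

Lemma weil_mx_egorov g h : g \in SL2 p ->
  opmx (heis_rep R h) *m W g = W g *m opmx (heis_rep R (heis_act g h)).
Proof.
move=> gS; rewrite -(weil_egorov rho_weil) // !opmx_comp.
have rVr : (rho g \o rho g^-1%g)%VF = \1%VF.
  by rewrite -(weilM rho_weil) ?groupV // mulgV (weil1 rho_weil).
have rrV : (rho g^-1%g \o rho g)%VF = \1%VF.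
  by rewrite -(weilM rho_weil) ?groupV // mulVg (weil1 rho_weil).
(* The inverse of an endomorphism is only characterised when its kernel is trivial, which is checked
   first. *)
have -> : ((rho g)^-1)%VF = rho g^-1%g.
  have k0 : lker (rho g) == 0%VS.
    apply/lker0P/(can_inj (g := rho g^-1%g)) => f.
    by rewrite -comp_lfunE rrV id_lfunE.
  by rewrite -[RHS]comp_lfun1l -(lker0_compVf k0) -comp_lfunA rVr comp_lfun1r.
by rewrite mulmxA weil_mxV // mul1mx.
Qed.

(** Multiply [twirl] for rho(g) by rho(g^-1) and take traces. The right side is p tr rho(g) tr
    rho(g^-1). On the left, the intertwining relation turns each term into the trace of a Heisenberg
    operator with vector v - g v, which vanishes unless v = 0; that term is p. *)
Lemma weil_mx_traceV g : g \in SL2 p -> GLval g - 1%:M \in unitmx ->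
  \tr (W g) * \tr (W g^-1%g) = 1.
Proof.
move=> gS g1.
have p0 : p%:R != 0 :> R[i] by rewrite pnatr_eq0 -lt0n prime_gt0.
have := congr1 (fun M => \tr (W g^-1%g *m M)) (twirl p_pr p_odd (W g)).
rewrite mulmx_sumr raddf_sum /= mul_mx_scalar mxtraceZ -mulrA => E.
have S v : \tr (W g^-1%g *m (opmx (heis_rep R (- v, 0)) *m W g *m opmx (heis_rep R (v, 0))))
    = psi R (2%:R^-1 * symp v (GLval g *m - v)) * (v == 0)%:R * p%:R.
  rewrite weil_mx_egorov // !mulmxA -{2}(invgK g) weil_mxV ?groupV // mul1mx.
  rewrite -opmx_comp -heis_repM // trace_opmx_heis //= !add0r; congr (_ * (nat_of_bool _)%:R * _).
  apply/eqP/eqP => [e|->]; last by rewrite oppr0 mulmx0 addr0.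
  have : (GLval g - 1%:M) *m v = 0.
    by rewrite mulmxBl mul1mx -[LHS]opprK opprB -mulmxN e oppr0.
  by move/(congr1 (mulmx (invmx (GLval g - 1%:M)))); rewrite mulmxA mulVmx // mul1mx mulmx0.
apply: (mulfI p0); rewrite [\tr (W g) * _]mulrC in E *; rewrite -E.
rewrite (bigD1 0) //= big1 => [|v v0]; last by rewrite S (negPf v0) mulr0 mul0r.
by rewrite S /symp !mxE !mul0r subrr mulr0 psi0 eqxx !mul1r addr0 mulr1.
Qed.

(** The determinant is a multiplicative character, and its p-th power is trivial on the unipotent
    generators. *)
Lemma weil_mx_detXp g : g \in SL2 p -> \det (W g) ^+ p = 1.
Proof.
move: g; apply: (SL2_unipotent_ind p_pr) => [g gS gp|g h gS hS eg eh].
  have H k : \det (W (g ^+ k)%g) = \det (W g) ^+ k.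
    elim: k => [|k IH]; first by rewrite expg0 (weil1 rho_weil) opmx1 det1.
    by rewrite expgSr exprS weil_mxM ?groupX // det_mulmx IH.
  by rewrite -H gp (weil1 rho_weil) opmx1 det1.
by rewrite weil_mxM // det_mulmx exprMn eg eh mulr1.
Qed.
End WeilMatrices.

(** * Eigenvalue multiplicities *)

(** The matrix factors through the coordinates in the support of [e], which bounds the rank above;
    its restriction to the support is invertible, which bounds it below. *)
Lemma rank_diag_mx (F : fieldType) n (e : 'rV[F]_n) :
  \rank (diag_mx e) = #|[set i | e 0 i != 0]|.
Proof.
set S := [set i | _].
pose B : 'M[F]_(#|S|, n) := \matrix_(k, j) (enum_val k == j)%:R.
pose B' : 'M[F]_(n, #|S|) := \matrix_(i, k) (e 0 i *+ (enum_val k == i)).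
have eBB : diag_mx e = B' *m B.
  apply/matrixP => i j; rewrite !mxE.
  have [e0|e0] := eqVneq (e 0 i) 0.
    by rewrite e0 mul0rn big1 // => k _; rewrite !mxE e0 mul0rn mul0r.
  have iS : i \in S by rewrite inE.
  rewrite (bigD1 (enum_rank_in iS i)) //= big1 => [|k ki].
    by rewrite !mxE enum_rankK_in // eqxx mulr1n addr0 mulr_natr.
  rewrite !mxE; case: eqVneq => [ik|_]; last by rewrite mulr0n mul0r.
  by case/eqP: ki; apply: enum_val_inj; rewrite enum_rankK_in.
have BeB : B *m diag_mx e *m B^T = diag_mx (\row_k e 0 (enum_val k)).
  apply/matrixP => k l; rewrite !mxE (bigD1 (enum_val l)) //= big1 => [|j jl].
    rewrite addr0 mul_mx_diag !mxE eqxx mulr1 (inj_eq enum_val_inj).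
    by case: eqVneq => [->|_]; rewrite ?mul1r ?mul0r.
  by rewrite !mxE eq_sym (negPf jl) mulr0.
apply/eqP; rewrite eqn_leq; apply/andP; split.
  by rewrite eBB (leq_trans (mxrankM_maxl _ _)) ?rank_leq_col.
have <- : \rank (diag_mx (\row_k e 0 (enum_val k) : 'rV_#|S|)) = #|S|.
  apply: mxrank_unit; rewrite unitmxE det_diag unitfE; apply/prodf_neq0 => k _.
  by rewrite mxE; have := enum_valP k; rewrite inE.
by rewrite -BeB (leq_trans (mxrankM_maxl _ _)) ?mxrankM_maxr.
Qed.

Section RootsOfUnity.
Variables (C : numClosedFieldType) (n : nat) (n_gt0 : (0 < n)%N).

Lemma unity_roots_exist : exists rs : seq C,
  [/\ uniq rs, size rs = n, forall z, (z \in rs) = (z ^+ n == 1)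
    & 'X^n - 1 = \prod_(z <- rs) ('X - z%:P) :> {poly C}].
Proof.
have [rs rsE] := closed_field_poly_normal ('X^n - 1 : {poly C}).
move: rsE; rewrite lead_coefDl ?size_polyN ?size_poly1 ?size_polyXn // lead_coefXn scale1r => rsE.
exists rs; split=> //.
- by rewrite -separable_prod_XsubC -rsE separable_Xn_sub_1 // pnatr_eq0 -lt0n.
- by apply/succn_inj; rewrite -(size_prod_XsubC _ id) -rsE size_XnsubC.
- by move=> z; rewrite -root_prod_XsubC -rsE rootE !hornerE subr_eq0.
Qed.

Lemma sum_unity_root (w : C) : w ^+ n = 1 -> \sum_(k < n) w ^+ k = (w == 1)%:R * n%:R.
Proof.
move=> wn; have [->|w1] := eqVneq w 1.
  by under eq_bigr do rewrite expr1n; rewrite sumr_const card_ord mul1r.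
rewrite mul0r; apply/eqP; have := subrX1 w n; rewrite wn subrr => /esym/eqP.
by rewrite mulf_eq0 subr_eq0 (negPf w1).
Qed.

End RootsOfUnity.

Lemma big_fibers (R : Type) (idx : R) (op : Monoid.com_law idx) (I : finType)
    (T : eqType) (rs : seq T) (d : I -> T) (F : T -> R) :
  uniq rs -> (forall i, d i \in rs) ->
  \big[op/idx]_i F (d i) = \big[op/idx]_(z <- rs) \big[op/idx]_(i | d i == z) F z.
Proof.
move=> rsU drs; rewrite (exchange_big_dep xpredT) //=; apply: eq_bigr => i _.
rewrite big_mkcond (bigD1_seq (d i)) //= eqxx big1 ?Monoid.mulm1 // => z zd.
by rewrite eq_sym (negPf zd).
Qed.

(** A nonzero integer square is at least 1, so a single one exhausts the sum. *)
Lemma one_unit_square (T : eqType) (rs : seq T) (e : T -> int) :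
  \sum_(z <- rs) e z ^+ 2 = 1 -> uniq rs ->
  exists2 z0, z0 \in rs & {in rs, forall z, z != z0 -> e z = 0}.
Proof.
move=> s1 rsU.
have [|none] := boolP (has (fun z => e z != 0) rs); last first.
  suff : \sum_(z <- rs) e z ^+ 2 = 0 by rewrite s1.
  rewrite big_seq big1 // => z zrs; move/hasPn: none => /(_ z zrs).
  by rewrite negbK => /eqP ->.
case/hasP => z0 z0rs ez0; exists z0 => // z zrs zz0.
move: s1; rewrite (bigD1_seq z0) //= => s1.
have sge : 0 <= \sum_(z <- rs | z != z0) e z ^+ 2 by apply: sumr_ge0 => i _; rewrite sqr_ge0.
have e1 : 1 <= e z0 ^+ 2.
  have : 0 < e z0 ^+ 2 by rewrite lt_def sqr_ge0 expf_eq0 /= ez0.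
  by [].
have : \sum_(z <- rs | z != z0) e z ^+ 2 <= 0.
  by rewrite -(lerD2l (e z0 ^+ 2)) s1 addr0.
move=> sle; have /eqP : \sum_(z <- rs | z != z0) e z ^+ 2 == 0 by rewrite eq_le sle sge.
rewrite big_seq_cond => /eqP; rewrite psumr_eq0 => [/allP/(_ z zrs)|i _]; last exact: sqr_ge0.
by rewrite zrs zz0 expf_eq0 /= => /eqP.
Qed.

(* With m_z the multiplicities, the traces give sum (m_z - 1)^2 = 1, so exactly
   one m_z differs from 1, by N - n = +-1; the determinant forces z = -1 there. *)
Lemma unity_eigenvalue_mult (C : numClosedFieldType) (N n : nat) (d : 'I_N -> C) :
  (0 < n)%N -> ~~ odd n -> n = N.+1 \/ n.+1 = N ->
  (forall i, d i ^+ n = 1) ->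
  (forall k, (0 < k < n)%N -> (\sum_i d i ^+ k) * (\sum_i (d i)^-1 ^+ k) = 1) ->
  \prod_i d i = 1 ->
  forall z, z ^+ n = 1 ->
    #|[set i | d i == z]| = if z == -1 then (1 + N - n)%N else 1%N.
Proof.
move=> n_gt0 n_even nN dn dtr ddet.
have [rs [rsU rs_size rsE rs_poly]] := @unity_roots_exist C n n_gt0.
(* This is the constant coefficient of X^n - 1. *)
have rs_prod : \prod_(z <- rs) - z = -1.
  have := congr1 (horner^~ 0) rs_poly; rewrite !hornerE expr0n gtn_eqF // sub0r horner_prod => ->.
  by apply: eq_bigr => z _; rewrite hornerXsubC sub0r.
have drs i : d i \in rs by rewrite rsE dn.
pose m z := #|[set i | d i == z]|.
have msum : (\sum_(z <- rs) m z = N)%N.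
  transitivity (\sum_(i < N) 1)%N; last by rewrite sum1_card card_ord.
  rewrite (big_fibers _ (d := d) (fun=> 1%N) rsU drs); apply: eq_bigr => z _.
  by rewrite sum1_card /m cardsE.
(* The products of power sums are added over 0 <= k < n. The term k = 0 is N^2 and the others are 1;
   exchanging the sums, orthogonality of roots of unity leaves n for each pair with d i = d j. *)
have msqr : (n * \sum_(z <- rs) m z * m z = N * N + (n - 1))%N.
  apply/eqP; rewrite -(eqr_nat C); apply/eqP.
  transitivity (\sum_(k < n) (\sum_i d i ^+ k) * (\sum_i (d i)^-1 ^+ k)); last first.
    rewrite -(prednK n_gt0) big_ord_recl subn1 natrD /=; congr (_ + _).
      have s0 (f : 'I_N -> C) : \sum_i f i ^+ 0 = N%:R.
        by under eq_bigr do rewrite expr0; rewrite sumr_const card_ord.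
      by rewrite natrM; congr (_ * _); [exact: (s0 d)|exact: (s0 (fun i => (d i)^-1))].
    transitivity (\sum_(k < n.-1) (1 : C)); last by rewrite sumr_const card_ord.
    by apply: eq_bigr => k _; rewrite dtr // /bump /=; have := ltn_ord k; lia.
  have dnz i : d i != 0.
    by apply: contra_eq_neq (dn i) => ->; rewrite expr0n gtn_eqF // eq_sym oner_neq0.
  transitivity (\sum_i \sum_j \sum_(k < n) (d i / d j) ^+ k).
    rewrite natrM; transitivity (\sum_i (n%:R * (m (d i))%:R : C)).
      rewrite -mulr_sumr (big_fibers _ (d := d) (fun z => (m z)%:R) rsU drs).
      congr (_ * _); rewrite natr_sum; apply: eq_bigr => z _.
      by rewrite sumr_const mulrnA; congr (_ *+ _); rewrite /m cardsE.
    apply: eq_bigr => i _.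
    transitivity (\sum_j ((d j == d i)%:R * n%:R : C)).
      rewrite -mulr_suml mulrC /m -sum1dep_card natr_sum big_mkcond; congr (_ * _).
      by apply: eq_bigr => j _; case: (d j == d i).
    apply: eq_bigr => j _; rewrite sum_unity_root; last by rewrite expr_div_n !dn divr1.
    by rewrite -[_ / _ == 1](inj_eq (mulIf (dnz j))) mulfVK // mul1r eq_sym.
  under eq_bigr do rewrite exchange_big /=.
  rewrite exchange_big; apply: eq_bigr => k _; rewrite mulr_suml; apply: eq_bigr => i _.
  by rewrite mulr_sumr; apply: eq_bigr => j _; rewrite exprMn.
pose e z : int := (m z)%:Z - 1.
have zsum f : \sum_(z <- rs) (f z)%:Z = (\sum_(z <- rs) f z)%N%:Z.
  by rewrite (big_morph Posz PoszD (erefl _)).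
have z1 : \sum_(z <- rs) (1 : int) = n%:Z.
  by rewrite big_const_seq count_predT rs_size iter_addr_0 natz.
have esum : \sum_(z <- rs) e z = N%:Z - n%:Z.
  by rewrite sumrB zsum msum z1.
have esqr : \sum_(z <- rs) e z ^+ 2 = 1.
  have E z : e z ^+ 2 = (m z * m z)%:Z - (m z)%:Z *+ 2 + 1.
    by rewrite /e PoszM; ring.
  under eq_bigr do rewrite E.
  rewrite !big_split /= sumrN sumrMnl z1 !zsum msum.
  (* The sum s of the m_z^2 is N if n = N + 1, and n + 3 if n = N - 1; in both cases s - 2N + n =
     1. *)
  move: (\sum_(z <- rs) _)%N msqr => s; case: nN => nE.
    rewrite nE => hs; suff -> : s = N by lia.
    by apply/eqP; rewrite -(eqn_pmul2l (ltn0Sn N)); apply/eqP; rewrite hs; nia.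
  rewrite -nE => hs; suff -> : s = (n + 3)%N by lia.
  by apply/eqP; rewrite -(eqn_pmul2l n_gt0); apply/eqP; rewrite hs; nia.
have [z0 z0rs ez] := one_unit_square esqr rsU.
have m1 z : z \in rs -> z != z0 -> m z = 1%N.
  by move=> zrs /(ez z zrs) /eqP; rewrite /e subr_eq0 => /eqP [].
have ez0 : (m z0 + n = 1 + N)%N.
  move: esum; rewrite (bigD1_seq z0) //= big_seq_cond big1 => [|z /andP[zrs zz0]]; last exact: ez.
  by rewrite /e addr0; lia.
(* As n is even, all n-th roots of unity multiply to -1, while the product of the z^(m_z) is 1. The
   quotient gives z0^(m_z0 - 1) = -1, with exponent 1 or -1. *)
have z0E : z0 = -1.
  have prs : \prod_(z <- rs) z = -1.
    rewrite -rs_prod; under [RHS]eq_bigr do rewrite -mulN1r.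
    rewrite big_split /= big_const_seq count_predT rs_size iter_mulr_1.
    by rewrite -signr_odd (negPf n_even) mul1r.
  have dm : \prod_(z <- rs) z ^+ m z = 1.
    rewrite -[RHS]ddet [RHS](big_fibers _ (d := d) id rsU drs); apply: eq_bigr => z _.
    by rewrite prodr_const /m cardsE.
  move: prs dm; rewrite !(bigD1_seq z0) //=.
  have -> : \prod_(z <- rs | z != z0) z ^+ m z = \prod_(z <- rs | z != z0) z.
    rewrite -big_filter -[RHS]big_filter; apply: eq_big_seq => z.
    by rewrite mem_filter => /andP[zz0 zrs]; rewrite m1.
  move: (\prod_(z <- rs | _) z) => P z0P.
  have [->|->] : m z0 = 0%N \/ m z0 = 2%N by case: nN => nE; [left|right]; lia.
    by rewrite expr0 mul1r => P1; rewrite -z0P P1 mulr1.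
  by rewrite expr2 -mulrA z0P mulrN1 => /eqP; rewrite eqr_oppLR => /eqP.
move=> z /eqP; rewrite -rsE => zrs; rewrite -/(m z).
have [->|zz0] := eqVneq z (-1); last by rewrite m1 // z0E.
by rewrite -z0E -ez0 addnK.
Qed.

(** The minimal polynomial divides X^n - 1, whose roots are simple. *)
Lemma finite_order_diagonalizable (C : numClosedFieldType) N n (M : 'M[C]_N.+1) :
  (0 < n)%N -> M ^+ n = 1 ->
  exists2 P, P \in unitmx & exists d : 'rV[C]_N.+1, M = invmx P *m diag_mx d *m P.
Proof.
move=> n_gt0 Mn; have [rs [rsU _ _ rs_poly]] := @unity_roots_exist C n n_gt0.
have [|P uP] := (@diagonalizableP _ _ M).2.
  exists rs => //; rewrite -rs_poly; apply: mxminpoly_min.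
  by rewrite rmorphB rmorphXn rmorph1 /= horner_mx_X Mn subrr.
case/similar_diagPex => d /(simmxP uP) PM; exists P => //; exists d.
by rewrite -mulmxA -PM mulKmx.
Qed.

(** In a basis diagonalizing [M], its inverse [M'] has the inverse entries, and the rank of M - z
    counts the diagonal entries other than z; this reduces to [unity_eigenvalue_mult]. *)
Lemma finite_order_eigenspace_dim (C : numClosedFieldType) N n (M M' : 'M[C]_N.+1) :
  (0 < n)%N -> ~~ odd n -> n = N.+2 \/ n.+1 = N.+1 ->
  M ^+ n = 1 -> M * M' = 1 ->
  (forall k, (0 < k < n)%N -> \tr (M ^+ k) * \tr (M' ^+ k) = 1) ->
  \det M = 1 ->
  forall z, z ^+ n = 1 ->
    (N.+1 - \rank (M - z%:M)%R)%N = if z == -1 then (N.+2 - n)%N else 1%N.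
Proof.
move=> n_gt0 n_even nN Mn MM' trM detM z zn.
have [P uP [d ME]] := finite_order_diagonalizable n_gt0 Mn.
have conjX (e : 'rV[C]_N.+1) k : (invmx P *m diag_mx e *m P) ^+ k =
    invmx P *m diag_mx (\row_i e 0 i ^+ k) *m P.
  elim: k => [|k IH].
    rewrite expr0; have -> : diag_mx (\row_i e 0 i ^+ 0) = 1%:M.
      by apply/matrixP => i j; rewrite !mxE expr0.
    by rewrite mulmx1 mulVmx.
  rewrite exprS IH -[LHS]/(_ *m _) !mulmxA mulmxK //; congr (_ *m _).
  rewrite -mulmxA mulmx_diag; congr (_ *m diag_mx _).
  by apply/rowP => i; rewrite !mxE exprS.
have trX (e : 'rV[C]_N.+1) k : \tr ((invmx P *m diag_mx e *m P) ^+ k) = \sum_i e 0 i ^+ k.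
  rewrite conjX mxtrace_mulC mulmxA mulmxV // mul1mx mxtrace_diag.
  by apply: eq_bigr => i _; rewrite mxE.
have dn i : d 0 i ^+ n = 1.
  have : P *m M ^+ n *m invmx P = 1%:M by rewrite Mn mulmx1 mulmxV.
  rewrite ME conjX !mulmxA mulmxV // mul1mx mulmxK //.
  by move/matrixP => /(_ i i); rewrite !mxE eqxx.
have dnz i : d 0 i != 0.
  by apply: contra_eq_neq (dn i) => ->; rewrite expr0n gtn_eqF // eq_sym oner_neq0.
have M'E : M' = invmx P *m diag_mx (\row_i (d 0 i)^-1) *m P.
  have [uM _] := mulmx1_unit (MM' : M *m M' = 1%:M).
  apply: (can_inj (mulKmx uM)); rewrite [LHS]MM' ME !mulmxA mulmxK //.
  rewrite -[_ *m diag_mx d *m _]mulmxA mulmx_diag.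
  have -> : diag_mx (\row_j (d 0 j * (\row_i (d 0 i)^-1) 0 j)) = 1%:M.
    by apply/matrixP => i j; rewrite !mxE divff.
  by rewrite mulmx1 mulVmx.
have -> : M - z%:M = invmx P *m diag_mx (\row_i (d 0 i - z)) *m P.
  have -> : diag_mx (\row_i (d 0 i - z)) = diag_mx d - z%:M.
    by apply/matrixP => i j; rewrite !mxE mulrnBl.
  by rewrite mulmxBr mulmxBl -ME scalar_mxC mulmxKV.
rewrite mxrankMfree ?row_free_unit // -mxrank_tr trmx_mul mxrankMfree; last first.
  by rewrite row_free_unit unitmx_tr unitmx_inv.
rewrite mxrank_tr rank_diag_mx.
have <- := @unity_eigenvalue_mult C N.+1 n (fun i => d 0 i) n_gt0 n_even nN dn _ _ z zn.
- have -> : [set i | (\row_i (d 0 i - z)) 0 i != 0] = ~: [set i | d 0 i == z].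
    by apply/setP => i; rewrite !inE !mxE subr_eq0.
  rewrite cardsCs setCK card_ord subKn; first by apply: eq_card => i; rewrite !inE.
  by rewrite -[X in (_ <= X)%N](card_ord N.+1) max_card.
- by move=> k /trM; rewrite ME M'E !trX => <-; congr (_ * _); apply: eq_bigr => i _; rewrite mxE.
- by rewrite -[RHS]detM ME !det_mulmx det_diag mulrAC -det_mulmx mulVmx // det1 mul1r.
Qed.

(** * Isotypic dimensions *)

Lemma expg_char (R : realType) (p : nat) (T : {group {'GL_2(p)}})
    (chi : {'GL_2(p)} -> R[i]) : is_char T chi ->
  {in T, forall g k, chi (g ^+ k)%g = chi g ^+ k}.
Proof.
move=> [chi1 chiM] g gT; elim=> [|k IH]; first by rewrite expg0.
by rewrite expgS chiM ?groupX // IH exprS.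
Qed.

(** An eigenvector of the generator is one for all its powers, so the intersection over [T]
    collapses to a single eigenspace. *)
Lemma isotypic_cycle (R : realType) (p : nat) (rho : {'GL_2(p)} -> 'End(Hilb R p))
    (T : {group {'GL_2(p)}}) (chi : {'GL_2(p)} -> R[i]) g0 :
  is_weil_rep rho -> T \subset SL2 p -> T :=: <[g0]>%g -> is_char T chi ->
  isotypic T rho chi = lker (rho g0 - chi g0 *: \1%VF)%VF.
Proof.
move=> rho_weil TS Tg chiP.
have g0T : g0 \in T by rewrite Tg cycle_id.
apply/vspaceP => phi; apply/isotypicP/idP => [h|].
  by rewrite memv_ker add_lfunE opp_lfunE scale_lfunE id_lfunE h // subrr.
rewrite memv_ker add_lfunE opp_lfunE scale_lfunE id_lfunE subr_eq0 => /eqP h g.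
rewrite Tg => /cycleP[k ->]; rewrite (expg_char chiP) //.
elim: k => [|k IH]; first by rewrite expg0 (weil1 rho_weil) id_lfunE scale1r.
rewrite expgS (weilM rho_weil) ?groupX ?(subsetP TS) // comp_lfunE IH linearZ /=.
by rewrite h scalerA -exprSr.
Qed.

Section Multiplicities.
Variables (R : realType) (p : nat) (p_pr : prime p) (p_odd : odd p).
Variables (rho : {'GL_2(p)} -> 'End(Hilb R p)) (rho_weil : is_weil_rep rho).
Variables (T : {group {'GL_2(p)}}) (sigma : {'GL_2(p)} -> R[i]).
Hypotheses (TS : T \subset SL2 p) (T_cyc : cyclic T).
Hypothesis T_fix : forall g, g \in T -> g != 1%g -> GLval g - 1%:M \in unitmx.
Hypothesis sigma2 : is_char_order2 T sigma.
Hypothesis cardT : #|T| = p.+1 \/ #|T|.+1 = p.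

(** A character of [T] is determined by its value at a generator g0, so the isotypic spaces are
    eigenspaces of rho(g0), whose multiplicities follow from the trace identity and the
    determinant. *)
Lemma isotypic_dim chi : is_char T chi ->
  (~ {in T, chi =1 sigma} -> \dim (isotypic T rho chi) = 1%N) /\
  ({in T, chi =1 sigma} -> \dim (isotypic T rho chi) = (p.+1 - #|T|)%N).
Proof.
move=> chiP; have /cyclicP[g0 Tg] := T_cyc.
have g0T : g0 \in T by rewrite Tg cycle_id.
have g0S := subsetP TS _ g0T.
have oT : #[g0]%g = #|T| by rewrite Tg.
have := cardT; set n := #|T| in oT * => nT.
have n_gt0 : (0 < n)%N by exact: cardG_gt0.
have n_even : ~~ odd n.
  by case: nT => [->|e]; [rewrite /= p_odd|move: p_odd; rewrite -e].
have WX k : opmx (rho (g0 ^+ k)%g) = opmx (rho g0) ^+ k.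
  elim: k => [|k IH]; first by rewrite expg0 (weil1 rho_weil) opmx1.
  by rewrite expgSr (weil_mxM rho_weil) ?groupX // IH exprS.
have VX k : opmx (rho ((g0 ^+ k)^-1)%g) = opmx (rho g0^-1%g) ^+ k.
  elim: k => [|k IH]; first by rewrite expg0 invg1 (weil1 rho_weil) opmx1.
  by rewrite expgS invMg (weil_mxM rho_weil) ?groupV ?groupX // IH exprS.
have Wn : opmx (rho g0) ^+ n = 1.
  by rewrite -WX -oT expg_order (weil1 rho_weil) opmx1.
(* Its p-th and n-th powers are 1, and p and n differ by one. *)
have detW : \det (opmx (rho g0)) = 1.
  have dp := weil_mx_detXp p_pr rho_weil g0S.
  have dn : \det (opmx (rho g0)) ^+ n = 1.
    have H k : \det (opmx (rho g0) ^+ k) = \det (opmx (rho g0)) ^+ k.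
      by elim: k => [|k IH]; rewrite ?expr0 ?det1 // !exprS -IH -det_mulmx.
    by rewrite -H Wn det1.
  move: (\det _) dp dn => D dp dn; case: nT => e; first by move: dn; rewrite e exprS dp mulr1.
  by move: dp; rewrite -e exprS dn mulr1.
have trW k : (0 < k < n)%N ->
    \tr (opmx (rho g0) ^+ k) * \tr (opmx (rho g0^-1%g) ^+ k) = 1.
  move=> /andP[k0 kn]; rewrite -WX -VX.
  apply: (weil_mx_traceV p_pr p_odd rho_weil); first by rewrite groupX.
  apply: T_fix; first by rewrite groupX.
  by rewrite -order_dvdn oT gtnNdvd.
have charE (xi xi' : {'GL_2(p)} -> R[i]) : is_char T xi -> is_char T xi' ->
    xi g0 = xi' g0 -> {in T, xi =1 xi'}.
  move=> xiP xiP' e g; rewrite Tg => /cycleP[k ->].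
  by rewrite (expg_char xiP) // (expg_char xiP') // e.
(* The value 1 at the generator would make [sigma] trivial on [T]. *)
have sg0 : sigma g0 = -1.
  have [sP [g gT sg] s2] := sigma2.
  have /eqP := s2 _ g0T; rewrite sqrf_eq1 => /orP[/eqP s1|/eqP //].
  case/eqP: sg; move: gT; rewrite Tg => /cycleP[k ->].
  by rewrite (expg_char sP) // s1 expr1n.
have chin : chi g0 ^+ n = 1.
  by rewrite -(expg_char chiP) // -oT expg_order; case: chiP.
have pN : p = (Zp_trunc (pdiv p)).+2 by rewrite Fp_cast.
have nN : n = (Zp_trunc (pdiv p)).+3 \/ n.+1 = (Zp_trunc (pdiv p)).+2.
  by case: nT => e; [left; rewrite e {1}pN|right; rewrite e {1}pN].
rewrite (isotypic_cycle rho_weil TS Tg chiP) dim_lker_opmx opmxB_scale.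
rewrite (finite_order_eigenspace_dim n_gt0 n_even nN Wn _ trW detW chin); last first.
  exact: weil_mxV rho_weil _ g0S.
split=> [ns|/(_ g0 g0T) ->]; last by rewrite sg0 eqxx; congr (_.+1 - _)%N; exact: esym pN.
case: eqVneq => // c; case: ns; apply: charE => //; first by case: sigma2.
by rewrite sg0.
Qed.
End Multiplicities.

Theorem theorem3 (R : realType) (p : nat) (p_prime : prime p) (p_odd : odd p)
    (rho : {'GL_2(p)} -> 'End(Hilb R p)) (rho_weil : is_weil_rep rho)
    (T : {group {'GL_2(p)}}) (T_max : is_max_torus T)
    (sigmaT : {'GL_2(p)} -> R[i]) (sigmaT_ord2 : is_char_order2 T sigmaT) :
  (is_split_torus T ->
     forall chi : {'GL_2(p)} -> R[i], is_char T chi ->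
       (~ {in T, chi =1 sigmaT} -> \dim (isotypic T rho chi) = 1%N) /\
       ({in T, chi =1 sigmaT} -> \dim (isotypic T rho chi) = 2%N)) /\
  (~ is_split_torus T ->
     forall chi : {'GL_2(p)} -> R[i], is_char T chi ->
       (~ {in T, chi =1 sigmaT} -> \dim (isotypic T rho chi) = 1%N) /\
       ({in T, chi =1 sigmaT} -> \dim (isotypic T rho chi) = 0%N)).
Proof.
have two := two_neq0_Fp p_prime p_odd.
have [Y [trY dY TE]] := max_torus_centralizer p_prime p_odd T_max.
have TS : T \subset SL2 p by apply/subsetP => g; rewrite TE => /andP[].
have T_cyc := torus_cyclic two trY dY TE (toFbar p).
have T_fix := torus_sub1_unit two trY dY TE.
have p1S : p.-1.+1 = p by rewrite prednK ?prime_gt0.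
split=> [spT|nspT] chi chiP.
  (* The exceptional dimension p + 1 - #|T| is 2 here, and 0 in the non-split case. *)
  have cT := card_split_torus p_prime spT.
  have [|d1 d2] := isotypic_dim p_prime p_odd rho_weil TS T_cyc T_fix sigmaT_ord2 _ chiP.
    by right; rewrite cT.
  by split=> // /d2 ->; rewrite cT -[in X in (X - _)%N]p1S !subSn ?leqnSn // subnn.
have cT := card_nonsplit_torus p_prime two trY dY TE nspT.
have [|d1 d2] := isotypic_dim p_prime p_odd rho_weil TS T_cyc T_fix sigmaT_ord2 _ chiP.
  by left.
by split=> // /d2 ->; rewrite cT subnn.
Qed.
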